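(* Let $\mathbf H$ be a real Hilbert space and let $\mathbf S,\mathbf A,\mathbf C,\mathbf M,\beta,\rho,\hat\rho,\zeta,\tau$ satisfy the standing assumptions (a)–(e) listed in the context, with $\operatorname{zer}(\mathbf A+\mathbf C)\neq\varnothing$. Let $\theta\in\,]0,2[$; let $\eta=1$ if $\theta\in[1,2[$ and $\mathbf S-\tau\mathbf M$ is monotone, and $\eta=1+|1-\theta|$ otherwise; let $\xi=\tau\zeta_{\mathbf M}\in[1-\zeta,1+\zeta]$, where $\zeta_{\mathbf M}$ is the Lipschitz modulus of $\mathbf M$ with respect to $\mathbf S$. Let $(x_0,u_0)\in\mathbf H^2$ and let $(x_n,u_n)_{n\ge1}$ be generated by $$(\forall n\in\mathbb N)\quad\begin{cases}p_{n+1}=(\mathbf M+\mathbf A)^{-1}(\mathbf Mx_n-\mathbf Cx_n+u_n/\tau)\\ u_{n+1}=(\tau\mathbf M-\mathbf S)p_{n+1}-(\tau\mathbf M-\mathbf S)x_n\\ x_{n+1}=(1-\theta)x_n+\theta p_{n+1}.\end{cases}$$ Consider one of the following settings: (i) $\tau\mathbf M=\mathbf S$ (i.e. $\zeta=0$), $\overline\theta=\dfrac{2}{1+\sqrt{-\hat\rho/\beta}}$, $$\tau_{1,0}=(2-\theta)(\beta+\hat\rho)-2\hat\rho-\sqrt{((2-\theta)(\beta+\hat\rho)-2\hat\rho)^2+4\hat\rho\beta},$$ $$\tau_{2,0}=(2-\theta)(\beta+\hat\rho)-2\hat\rho+\sqrt{((2-\theta)(\beta+\hat\rho)-2\hat\rho)^2+4\hat\rho\beta};$$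 (ii) $\mathbf C=\mathbf 0$, $\overline\theta=2$, $\zeta<\overline\zeta=\frac{2-\theta}{2(\eta-4\hat\rho)}$, $\tau_{1,\zeta}=-2\hat\rho(\zeta+\xi)^2/\big(2-\theta-2(\eta-4\hat\rho)\zeta\big)$ and $\tau_{2,\zeta}=+\infty$; (iii) $\mathbf A$ is monotone, $\overline\theta=2$, $\zeta<\overline\zeta=\frac{2-\theta}{2\eta}$, $\tau_{1,\zeta}=0$ and $\tau_{2,\zeta}=2\beta(2-\theta-2\eta\zeta)$. Then, if $\theta\in\,]0,\overline\theta[$ and $\tau\in\,]\tau_{1,\zeta},\tau_{2,\zeta}[$, the sequence $(x_n)_{n\in\mathbb N}$ converges weakly to a point of $\operatorname{zer}(\mathbf A+\mathbf C)$; and if, in addition, $\mathbf A$ is $(\mu\mathbf S,\rho\mathbf S^{-1})$-semimonotone on $\mathbb S$ for some $\mu\in\,]0,+\infty[$, then $(x_n)_{n\in\mathbb N}$ converges R-linearly to the unique point of $\operatorname{zer}(\mathbf A+\mathbf C)$.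
   Context: For a set-valued operator $\mathbf A$, $\operatorname{zer}\mathbf A=\{x: 0\in \mathbf Ax\}$ and $\operatorname{gra}\mathbf A=\{(x,u):u\in \mathbf Ax\}$. For a bounded self-adjoint strongly monotone linear operator $\mathbf S$ (i.e. $\langle \mathbf Sx,x\rangle\ge m\|x\|^2$ for some $m>0$), $\|x\|_{\mathbf S}^2=\langle x,\mathbf Sx\rangle$. An operator $R:\mathbf H\to\mathbf H$ is $\beta$-cocoercive with respect to $\mathbf S$ if $\langle x-y,Rx-Ry\rangle\ge\beta\|Rx-Ry\|_{\mathbf S^{-1}}^2$ for all $x,y$; it is $\zeta$-Lipschitzian with respect to $\mathbf S$ if $\|Rx-Ry\|_{\mathbf S^{-1}}\le\zeta\|x-y\|_{\mathbf S}$ for all $x,y$; its Lipschitz modulus with respect to $\mathbf S$ is the smallest such $\zeta$. For bounded self-adjoint linear operators $M,N$ and a set $\mathcal S\subset\mathbf H^2$, a set-valued operator $\mathbf A$ is $(M,N)$-semimonotone on $\mathcal S$ if for all $(y,v)\in\mathcal S$ and $(x,u)\in\operatorname{gra}\mathbf A$, $\langle x-y,u-v\rangle\ge\langle x-y,M(x-y)\rangle+\langle u-v,N(u-v)\rangle$. It is $N$-comonotone on $\mathcal S$ if it is $(0,N)$-semimonotone on $\mathcal S$. A graph is sequentially weak-strong closed if $(x_n,u_n)$ in the graph, $x_n\rightharpoonup x$ and $u_n\to u$ imply that $(x,u)$ is in the graph. Standing assumptions. $\mathbf S:\mathbf H\to\mathbf H$ is bounded, linear, self-adjoint and strongly monotone;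 $\mathbf A:\mathbf H\to2^{\mathbf H}$ is set-valued; $\mathbf M:\mathbf H\to\mathbf H$ is single-valued; and: (a) $\mathbf C:\mathbf H\to\mathbf H$ is $\beta$-cocoercive with respect to $\mathbf S$ for some $\beta>0$; (b) $(\mathbf M+\mathbf A)^{-1}$ is single-valued and has full domain; (c) $\operatorname{gra}(\mathbf A+\mathbf C)$ is sequentially weak-strong closed; (d) $\mathbf A$ is $\rho\mathbf S^{-1}$-comonotone on $\mathbb S=\{(x,-\mathbf Cx): x\in\operatorname{zer}(\mathbf A+\mathbf C)\}$ for some $\rho\in\,]-\beta,+\infty[$; (e) with $\hat\rho=\min\{\rho,0\}$, there are $\zeta\in[0,1/2[$ and $\tau\in\,]\underline\tau_\zeta,+\infty[$, where $\underline\tau_\zeta=-\zeta\hat\rho/(\beta+\hat\rho)$, such that $\tau\mathbf M-\mathbf S$ is $\zeta$-Lipschitzian with respect to $\mathbf S$. R-linear convergence of $(x_n)$ to $x$: $\|x_n-x\|\le c\,r^n$ for some $c\ge0$, $r\in\,]0,1[$. *)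

(* Defs.v *)
From HB Require Import structures.
From mathcomp Require Import all_boot all_order all_algebra.
From mathcomp Require Import all_classical all_reals all_analysis.

Set Implicit Arguments.
Unset Strict Implicit.
Unset Printing Implicit Defensive.

Import Order.TTheory GRing.Theory Num.Theory.
Import numFieldNormedType.Exports.

Local Open Scope classical_set_scope.
Local Open Scope ring_scope.

(* A real Hilbert space is a complete normed module H over R together with an
   inner product ip : {dot H for idfun} (bilinear, symmetric and positive
   definite) that induces the norm of H. *)
Definition induces_norm (R : realType) (H : completeNormedModType R)
    (ip : {dot H for @idfun R}) : Prop :=
  forall x, `|x| ^+ 2 = ip x x.

Section SetValuedOperators.
Context {R : realType} {H : completeNormedModType R}.
Implicit Types A B : H -> set H.

Definition op_of_fun (f : H -> H) : H -> set H := fun x => [set f x].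

Definition op_add A B : H -> set H :=
  fun x => [set a + b | a in A x & b in B x].

Definition op_inv A : H -> set H := fun u => [set x | A x u].

Definition gra A : set (H * H) := [set z | A z.1 z.2].

Definition zer A : set H := [set x | A x 0].

End SetValuedOperators.

Section Operators.
Context {R : realType} {H : completeNormedModType R}.
Variable ip : {dot H for @idfun R}.
Implicit Types (S M N f : H -> H) (A : H -> set H).

Definition weakly_cvg (x : nat -> H) (l : H) : Prop :=
  forall y, ip (x n) y @[n --> \oo] --> ip l y.

Definition weak_strong_closed (G : set (H * H)) : Prop :=
  forall (x u : nat -> H) (a b : H), (forall n, G (x n, u n)) ->
    weakly_cvg x a -> u n @[n --> \oo] --> b -> G (a, b).

Definition R_linear_cvg (x : nat -> H) (l : H) : Prop :=
  exists c r : R,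
    [/\ 0 <= c, 0 < r < 1 & forall n, `|x n - l| <= c * r ^+ n].

Definition bounded_op f : Prop := exists k : R, forall x, `|f x| <= k * `|x|.

Definition self_adjoint f : Prop := forall x y, ip (f x) y = ip x (f y).

Definition strongly_monotone f : Prop :=
  exists2 m : R, 0 < m & forall x, m * `|x| ^+ 2 <= ip (f x) x.

(* The inverse of a bijection; a bounded self-adjoint strongly monotone linear
   operator on H is bijective, so the default value 0 is never used for it. *)
Definition inv_op S : H -> H := 'pinv_(fun=> 0) [set: H] S.

Definition sqnorm_wrt S (x : H) : R := ip x (S x).

Definition norm_wrt S (x : H) : R := Num.sqrt (sqnorm_wrt S x).

Definition cocoercive_wrt S (beta : R) f : Prop :=
  forall x y, beta * sqnorm_wrt (inv_op S) (f x - f y) <= ip (x - y) (f x - f y).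

Definition lipschitzian_wrt S (zeta : R) f : Prop :=
  forall x y, norm_wrt (inv_op S) (f x - f y) <= zeta * norm_wrt S (x - y).

(* Only nonnegative constants compete: if H is the zero space then every real
   number is a Lipschitz constant, and the modulus is 0. *)
Definition is_lipschitz_modulus S f (z : R) : Prop :=
  [/\ 0 <= z, lipschitzian_wrt S z f &
      forall z', 0 <= z' -> lipschitzian_wrt S z' f -> z <= z'].

Definition monotone_op A : Prop :=
  forall z w, gra A z -> gra A w -> 0 <= ip (z.1 - w.1) (z.2 - w.2).

Definition semimonotone_on (E : set (H * H)) M N A : Prop :=
  forall y v x u, E (y, v) -> gra A (x, u) ->
    ip (x - y) (M (x - y)) + ip (u - v) (N (u - v)) <= ip (x - y) (u - v).

Definition comonotone_on (E : set (H * H)) N A : Prop :=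
  semimonotone_on E (fun=> 0) N A.

End Operators.

Section Problem.
Context {R : realType} {H : completeNormedModType R}.
Variable ip : {dot H for @idfun R}.
Variables (S : {linear H -> H}) (A : H -> set H) (C M : H -> H).
Variables (beta rho zeta tau : R).

Definition zer_sum : set H := zer (op_add A (op_of_fun C)).

Definition zer_pairs : set (H * H) :=
  [set z | zer_sum z.1 /\ z.2 = - C z.1].

Definition rho_hat : R := Num.min rho 0.

Definition tau_low : R := - (zeta * rho_hat) / (beta + rho_hat).

Definition tauM_sub_S : H -> H := fun x => tau *: M x - S x.

Record standing_assumptions : Prop := StandingAssumptions {
  S_bounded : bounded_op S;
  S_self_adjoint : self_adjoint ip S;
  S_strongly_monotone : strongly_monotone ip S;
  beta_gt0 : 0 < beta;
  C_cocoercive : cocoercive_wrt ip S beta C;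
  resolvent_single_valued :
    forall w, exists! p, op_inv (op_add (op_of_fun M) A) w p;
  sum_closed : weak_strong_closed ip (gra (op_add A (op_of_fun C)));
  rho_gt : - beta < rho;
  A_comonotone :
    comonotone_on ip zer_pairs (fun x => rho *: inv_op S x) A;
  zeta_bounds : 0 <= zeta < 2^-1;
  tau_gt : tau_low < tau;
  kernel_lipschitz : lipschitzian_wrt ip S zeta tauM_sub_S
}.

Definition generated (theta : R) (x u p : nat -> H) : Prop :=
  forall n,
    [/\ op_inv (op_add (op_of_fun M) A)
          (M (x n) - C (x n) + tau^-1 *: u n) (p n.+1),
        u n.+1 = tauM_sub_S (p n.+1) - tauM_sub_S (x n) &
        x n.+1 = (1 - theta) *: x n + theta *: p n.+1].

Definition eta_of (theta : R) : R :=
  if (1 <= theta < 2) &&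
     `[< monotone_op ip (op_of_fun (fun x => S x - tau *: M x)) >]
  then 1 else 1 + `|1 - theta|.

Local Notation rh := rho_hat.

(* In each setting, theta_bar, t1 and t2 are the bounds used in the conditions
   theta < theta_bar and t1 < tau < t2. *)

Definition setting_i (theta theta_bar t1 : R) (t2 : \bar R) : Prop :=
  let b := (2 - theta) * (beta + rh) - 2 * rh in
  [/\ (forall x, tau *: M x = S x) /\ zeta = 0,
      theta_bar = 2 / (1 + Num.sqrt (- rh / beta)),
      t1 = b - Num.sqrt (b ^+ 2 + 4 * rh * beta) &
      t2 = (b + Num.sqrt (b ^+ 2 + 4 * rh * beta))%:E].

Definition setting_ii (theta xi theta_bar t1 : R) (t2 : \bar R) : Prop :=
  let eta := eta_of theta in
  [/\ forall x, C x = 0,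
      theta_bar = 2,
      zeta < (2 - theta) / (2 * (eta - 4 * rh)),
      t1 = - 2 * rh * (zeta + xi) ^+ 2 /
             (2 - theta - 2 * (eta - 4 * rh) * zeta) &
      t2 = +oo%E].

Definition setting_iii (theta theta_bar t1 : R) (t2 : \bar R) : Prop :=
  let eta := eta_of theta in
  [/\ monotone_op ip A,
      theta_bar = 2,
      zeta < (2 - theta) / (2 * eta),
      t1 = 0 &
      t2 = (2 * beta * (2 - theta - 2 * eta * zeta))%:E].

End Problem.

(* Main.v *)
Require Import Defs.
From HB Require Import structures.
From mathcomp Require Import all_boot all_order all_algebra.
From mathcomp Require Import all_classical all_reals all_analysis.
From mathcomp Require Import ring lra.
Import Order.TTheory GRing.Theory Num.Theory.
Import numFieldNormedType.Exports.
Local Open Scope classical_set_scope.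
Local Open Scope ring_scope.

(* In the inner product [B x y = <x, S y>] the operator S becomes the identity.
   With r_n = x_n - p_{n+1} and U_n = S^-1 u_n, the Lyapunov function
     |x_n - z|^2 + 2 theta <x_n - z, U_n> + theta kappa |r_{n-1}|^2
   decreases for every zero z by at least a multiple of |r_n|^2 + |r_{n-1}|^2;
   each setting enters only through a quadratic form in
   (r_n, U_n, U_{n+1}, C x_n - C z), whose positivity is the condition on tau.
   Hence r_n -> 0 and |x_n - z| converges, and weak convergence follows from
   Opial's argument.  Under semimonotonicity the decrease also controls
   |p_{n+1} - z|^2, hence the Lyapunov function itself, so that the latter decays
   geometrically. *)

(** The [r_{n-1}] term is forced by the momentum: [U_n] comes from a difference of values of
    [tau M - S], so it is controlled only by [zeta |r_{n-1}|], and a step may lose a multiple of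
    [|r_{n-1}|^2]. In every setting the quadratic form is therefore bounded below by [(kappa + eps)
    |r_n|^2 - (kappa - eps) |r_{n-1}|^2]: the [kappa] parts telescope and [eps] times both squares
    remains. The condition [zeta <= kappa] makes the Lyapunov function dominate
    [(1 - theta zeta) |x_n - z|^2], and this factor is positive because [theta < 2] and
    [zeta < 1/2]. As [u_0] is arbitrary, the descent starts at index 1. *)

Section DotForm.
Context {R : realType} {H : lmodType R} (B : {dot H for @idfun R}).
Implicit Types x y z : H.

Lemma dotC x y : B x y = B y x.
Proof. by rewrite hermC expr0 mul1r. Qed.

Lemma dotDl x y z : B (x + y) z = B x z + B y z.
Proof. exact: linearDl. Qed.

Lemma dotDr x y z : B z (x + y) = B z x + B z y.
Proof. exact: linearDr. Qed.

Lemma dotNl x y : B (- x) y = - B x y.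
Proof. exact: linearNl. Qed.

Lemma dotNr x y : B x (- y) = - B x y.
Proof. exact: linearNr. Qed.

Lemma dotZl a x y : B (a *: x) y = a * B x y.
Proof. exact: linearZl_LR. Qed.

Lemma dotZr a x y : B x (a *: y) = a * B x y.
Proof. exact: linearZr_LR. Qed.

Lemma dot0l x : B 0 x = 0.
Proof. exact: linear0l. Qed.

Lemma dot0r x : B x 0 = 0.
Proof. exact: linear0r. Qed.

Definition dotE := (dotDl, dotDr, dotNl, dotNr, dotZl, dotZr).

Lemma dot_ge0 x : 0 <= B x x.
Proof.
have [->|x0] := eqVneq x 0; first by rewrite dot0l.
exact/ltW/neq0_dnorm_gt0.
Qed.

Lemma dot_eq0 x : B x x = 0 -> x = 0.
Proof.
by move=> Bx; apply/eqP/negPn/negP => /(@neq0_dnorm_gt0 _ _ _ B); rewrite Bx ltxx.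
Qed.

Definition fnorm x := Num.sqrt (B x x).

Lemma fnorm_ge0 x : 0 <= fnorm x.
Proof. exact: sqrtr_ge0. Qed.

Lemma sqr_fnorm x : fnorm x ^+ 2 = B x x.
Proof. exact/sqr_sqrtr/dot_ge0. Qed.

Lemma dot_CauchySchwarz x y : B x y ^+ 2 <= B x x * B y y.
Proof.
have [->|y0] := eqVneq y 0; first by rewrite dotC !dot0l expr0n mulr0.
have By : 0 < B y y by exact: neq0_dnorm_gt0.
have := dot_ge0 (B y y *: x - B x y *: y).
rewrite !dotE (dotC y x) => h; rewrite -subr_ge0 -(pmulr_rge0 _ By).
by apply: (le_trans h); rewrite le_eqVlt; apply/orP; left; apply/eqP; ring.
Qed.

Lemma dot_le x y : B x y <= fnorm x * fnorm y.
Proof.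
rewrite /fnorm -sqrtrM ?dot_ge0//; apply: (le_trans (ler_norm _)).
by rewrite -sqrtr_sqr ler_wsqrtr// dot_CauchySchwarz.
Qed.

Lemma fnormN x : fnorm (- x) = fnorm x.
Proof. by rewrite /fnorm !dotE opprK. Qed.

Lemma fnormZ a x : 0 <= a -> fnorm (a *: x) = a * fnorm x.
Proof.
by move=> a0; rewrite /fnorm !dotE mulrA -expr2 sqrtrM ?sqr_ge0// sqrtr_sqr ger0_norm.
Qed.

Lemma dot_norm_le x y : `|B x y| <= fnorm x * fnorm y.
Proof. by rewrite ler_norml dot_le andbT lerNl -dotNl -(fnormN x) dot_le. Qed.

Lemma fnormD x y : fnorm (x + y) <= fnorm x + fnorm y.
Proof.
have h := fnorm_ge0; rewrite -(ler_pXn2r (_ : 0 < 2)%N) ?nnegrE ?addr_ge0 ?h//.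
rewrite sqr_fnorm !dotE (dotC y x) sqrrD !sqr_fnorm.
by have := dot_le x y; lra.
Qed.

End DotForm.

(** * Extraction from bounded double sequences *)

Lemma cvg_dist_le {R : realType} {V : normedModType R} (f : nat -> V) (l : V)
    (g : nat -> R) :
  (forall n, `|l - f n| <= g n) -> g n @[n --> \oo] --> 0 ->
  f n @[n --> \oo] --> l.
Proof.
move=> fg g0; apply/cvgrPdist_lt => e e0.
have /cvgrPdist_lt/(_ _ e0) := g0; apply: filterS => n /=.
rewrite sub0r normrN => ge; apply: (le_lt_trans (fg n)).
exact: le_lt_trans (ler_norm _) ge.
Qed.

(** Tychonoff replaces the diagonal argument: the rows lie in a product of segments, hence have a
    cluster point [g], and [phi j] selects a row of index at least [j] that is within [1/(j+1)] of
    [g] on the first [j] coordinates. The map [phi] may fail to be increasing; [n <= phi n] already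
    makes it tend to infinity. *)
Lemma bounded_double_subseq {R : realType} (a : nat -> nat -> R) (c : nat -> R) :
  (forall n k, `|a n k| <= c k) ->
  exists2 phi : nat -> nat, (forall n, (n <= phi n)%N) &
    forall k, cvgn (fun n => a (phi n) k).
Proof.
move=> ac.
pose K := [set f : prod_topology (fun=> R : topologicalType) |
  forall k : nat, `[- c k, c k]%classic (f k)].
have cK : compact K.
  have := @tychonoff nat (fun=> (R : topologicalType)) (fun k => `[- c k, c k]%classic).
  by apply => k; exact: segment_compact.
have aK : (a @ \oo) K.
  have h n : K (a n) by move=> k /=; rewrite in_itv/= -ler_norml.
  by exists 0 => // n _; exact: h.
have [g [_ gclus]] := cK (a @ \oo) _ aK.
have gnbhs e j : 0 < e -> nbhs g [set f | forall k, (k < j)%N -> `|g k - f k| < e].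
  move=> e0; elim: j => [|j IH]; first by apply: filterS filterT => f _ k.
  have hj : nbhs g [set f | `|g j - f j| < e].
    have pc := @proj_continuous nat (fun=> (R : topologicalType)) j g.
    by have := pc _ (nbhsx_ballx (g j : R) _ e0).
  apply: filterS (filterI IH hj) => f [h1 h2] k.
  by rewrite ltnS leq_eqVlt => /orP[/eqP ->//|/h1].
have ex j : exists n, (j <= n)%N /\
    forall k, (k < j)%N -> `|g k - a n k| < j.+1%:R^-1.
  have [||f [[n jn <-] h]] := gclus [set a n | n in [set n | (j <= n)%N]]
      [set f | forall k, (k < j)%N -> `|g k - f k| < j.+1%:R^-1] _ _.
  - by exists j => // n /= jn; exists n.
  - exact: gnbhs.
  - by exists n.
have [phi hphi] := choice ex.
exists phi => [n|k]; first by have [] := hphi n.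
apply/cvg_ex; exists (g k); apply/cvgrPdist_lt => e e0.
have kn : \forall n \near \oo, (k < n)%N by exists k.+1.
have := @cvg_harmonic R => /cvgrPdist_lt/(_ _ e0); apply: filterS2 kn => n /= kn.
rewrite sub0r normrN ger0_norm// => he.
by have [_ /(_ k kn)/lt_trans->] := hphi n.
Qed.

(** * Riesz representation and weak sequential compactness *)

Section NormEquivalent.
Context {R : realType} {H : completeNormedModType R} (B : {dot H for @idfun R}).
Variables (m k : R).
Hypotheses (m_gt0 : 0 < m) (k_ge0 : 0 <= k).
Hypothesis B_norm : forall x, m * `|x| ^+ 2 <= B x x <= k * `|x| ^+ 2.

Lemma fnorm_le x : fnorm B x <= Num.sqrt k * `|x|.
Proof.
have {1}-> : `|x| = Num.sqrt (`|x| ^+ 2) by rewrite sqrtr_sqr normr_id.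
by rewrite -sqrtrM// ler_wsqrtr//; have /andP[] := B_norm x.
Qed.

Lemma dot_cvgl (y : nat -> H) l v :
  y n @[n --> \oo] --> l -> B (y n) v @[n --> \oo] --> B l v.
Proof.
move=> yl; apply: (@cvg_dist_le _ _ _ _ (fun n => Num.sqrt k * `|l - y n| * fnorm B v)).
  move=> n; rewrite -dotNl -dotDl; apply: (le_trans (dot_norm_le _ _ _)).
  by rewrite ler_wpM2r ?fnorm_ge0 ?fnorm_le.
rewrite -[0](mul0r (fnorm B v)) -[X in X * _](mulr0 (Num.sqrt k)).
apply: cvgM; last exact: cvg_cst.
apply: cvgM; first exact: cvg_cst.
rewrite -[0](@normr0 _ H) -(subrr l); apply: cvg_norm; apply: cvgB => //; exact: cvg_cst.
Qed.


(* The representing vector minimises [B x x - 2 * f x] over [D]. *)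
Lemma riesz (D : set H) (f : H -> R) (c : R) :
  D 0 -> (forall a x y, D x -> D y -> D (a *: x + y)) ->
  (forall (y : nat -> H) l, (forall n, D (y n)) -> y n @[n --> \oo] --> l -> D l) ->
  (forall a x y, D x -> D y -> f (a *: x + y) = a * f x + f y) ->
  (forall x, D x -> `|f x| <= c * `|x|) ->
  exists2 w, D w & forall v, D v -> B w v = f v.
Proof.
move=> D0 Dlin Dcl flin fc.
pose J x := B x x - 2 * f x.
have J_lb x : D x -> - (c ^+ 2 / m) <= J x.
  move=> Dx; have /andP[Bx _] := B_norm x; have := fc _ Dx.
  rewrite ler_norml => /andP[_ fx].
  have : 0 <= (m * `|x| - c) ^+ 2 / m by rewrite divr_ge0 ?sqr_ge0 ?ltW.
  have -> : (m * `|x| - c) ^+ 2 / m = m * `|x| ^+ 2 - 2 * (c * `|x|) + c ^+ 2 / m.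
    by field; rewrite gt_eqF.
  by rewrite /J; lra.
have J_inf : has_inf (J @` D).
  split; first by exists (J 0), 0.
  by exists (- (c ^+ 2 / m)) => _ [x Dx <-]; exact: J_lb.
set I := inf (J @` D).
have I_le x : D x -> I <= J x.
  by move=> Dx; apply: ge_inf; [case: J_inf|exists x].
have ex n : exists y, D y /\ J y < I + n.+1%:R^-1.
  have /(inf_adherent) := J_inf => /(_ n.+1%:R^-1).
  by rewrite invr_gt0 ltr0n => /(_ isT)[_ [y Dy <-] Jy]; exists y.
have [y hy] := choice ex.
have Dy n : D (y n) by have [] := hy n.
have Jy n : J (y n) < I + n.+1%:R^-1 by have [] := hy n.
(* Parallelogram law: the midpoint of two near-minimisers lies in [D], so [J] is at least [I] there.
   The trailing [+ 0] in [z] puts it in the form that [Dlin] accepts. *)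
have ydist a b : m * `|y a - y b| ^+ 2 <= 2 * a.+1%:R^-1 + 2 * b.+1%:R^-1.
  have /andP[Bab _] := B_norm (y a - y b); apply: (le_trans Bab).
  pose z := 2^-1 *: y a + (2^-1 *: y b + 0).
  have Dz : D z by apply: (Dlin) => //; exact: Dlin.
  have f0 : f 0 = 0 by have := flin (-1) 0 0 D0 D0; rewrite scaler0 addr0; lra.
  have fz : f z = 2^-1 * f (y a) + 2^-1 * f (y b).
    rewrite /z (flin _ (y a))//; last by apply: (Dlin).
    by rewrite flin// f0 addr0.
  have := I_le _ Dz; have := Jy a; have := Jy b.
  rewrite /J fz /z addr0 !dotE (dotC B (y b) (y a)).
  by move: (a.+1%:R^-1) (b.+1%:R^-1) => u v h1 h2 h3; lra.
have /cauchy_cvgP/cvg_ex[/= w yw] : cauchy (y @ \oo).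
  apply: cauchy_exP => e e0.
  have e2 : 0 < m * e ^+ 2 / 4 by rewrite divr_gt0// mulr_gt0// exprn_gt0.
  have /cvgrPdist_lt/(_ _ e2)[N _ hN] := @cvg_harmonic R.
  exists (y N), N => // n /= Nn; rewrite -ball_normE /=.
  have := hN N (leqnn N); have := hN n Nn.
  rewrite /= !sub0r !normrN !ger0_norm ?invr_ge0// => h1 h2.
  rewrite -(ltr_pXn2r (_ : 0 < 2)%N) ?nnegrE ?(ltW e0)// -(ltr_pM2l m_gt0).
  by apply: (le_lt_trans (ydist _ _)); move: (N.+1%:R^-1) (n.+1%:R^-1) h1 h2 => u v h1 h2; lra.
exists w => [|v Dv]; first exact: Dcl yw.
(* First variation at the minimiser, obtained by comparing [I] with [J (t *: v + y n)] along the
   minimising sequence and passing to the limit. *)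
have key t : 0 <= 2 * t * (B w v - f v) + t ^+ 2 * B v v + 0.
  have cv : (2 * t * (B (y n) v - f v) + t ^+ 2 * B v v + harmonic n)
      @[n --> \oo] --> 2 * t * (B w v - f v) + t ^+ 2 * B v v + 0.
    apply: cvgD; last exact: cvg_harmonic.
    apply: cvgD; last exact: cvg_cst.
    apply: cvgM; first exact: cvg_cst.
    apply: cvgB; last exact: cvg_cst.
    exact: dot_cvgl.
  apply: (cvgr_to_ge cv); apply: nearW => n /=.
  have := I_le (t *: v + y n) (Dlin _ _ _ Dv (Dy n)); have := Jy n.
  rewrite /J flin// !dotE (dotC B v); move: (n.+1%:R^-1) => u h1 h2; lra.
apply/eqP; rewrite -subr_eq0; set g := B w v - f v in key *.
(* A nearly optimal [t]; the [+ 1] keeps the denominator positive when [v = 0]. *)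
have Bv := dot_ge0 B v; have := key (- g / (B v v + 1)).
have -> : 2 * (- g / (B v v + 1)) * g + (- g / (B v v + 1)) ^+ 2 * B v v + 0 =
   - (g ^+ 2 * ((B v v + 2) / (B v v + 1) ^+ 2)).
  by field; rewrite gt_eqF// ltr_wpDl.
rewrite oppr_ge0 pmulr_lle0 => [g2|]; last by rewrite divr_gt0 ?exprn_gt0 ?ltr_wpDl.
by rewrite -sqrf_eq0 eq_le g2 sqr_ge0.
Qed.

(** Extraction makes the products with every [x j] converge. The vectors [v] for which [B (y n) v]
    converges then form a closed subspace [D] containing all [y n]. An arbitrary [v] has a
    projection on [D], given by [riesz], with the same products against [y n]; this projection takes
    the place of a countable dense set. A second use of [riesz] represents the limit functional. *)
Lemma weakly_compact (x : nat -> H) (b : R) : (forall n, `|x n| <= b) ->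
  exists2 phi : nat -> nat, (forall n, (n <= phi n)%N) &
    exists l, weakly_cvg B (x \o phi) l.
Proof.
move=> xb.
have b_ge0 : 0 <= b by exact: le_trans (xb 0).
pose c v := Num.sqrt k * b * fnorm B v.
have Bxc n v : `|B (x n) v| <= c v.
  apply: (le_trans (dot_norm_le _ _ _)); rewrite ler_wpM2r ?fnorm_ge0//.
  by apply: (le_trans (fnorm_le _)); rewrite ler_wpM2l ?sqrtr_ge0.
have [phi phin phic] := @bounded_double_subseq _ (fun n j => B (x n) (x j))
  (c \o x) (fun n j => Bxc n (x j)).
exists phi => //.
pose y := x \o phi.
pose D := [set v | cvgn (fun n => B (y n) v)].
pose f v := limn (fun n => B (y n) v).
have fD v : D v -> B (y n) v @[n --> \oo] --> f v by [].
have DlinE a u v : D u -> D v ->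
    B (y n) (a *: u + v) @[n --> \oo] --> a * f u + f v.
  move=> Du Dv; under eq_cvg do rewrite dotDr dotZr.
  by apply: cvgD; [apply: cvgM; [exact: cvg_cst|exact: fD]|exact: fD].
have D0 : D 0 by apply/cvg_ex; exists 0; under eq_cvg do rewrite dotC dot0l; exact: cvg_cst.
have Dlin a u v : D u -> D v -> D (a *: u + v).
  by move=> Du Dv; apply/cvg_ex; exists (a * f u + f v); exact: DlinE.
have Dcl (z : nat -> H) l : (forall n, D (z n)) -> z n @[n --> \oo] --> l -> D l.
  move=> Dz zl; apply/cauchy_cvgP; apply: cauchy_exP => e e0.
  pose s := (Num.sqrt k * b) * Num.sqrt k + 1.
  have s0 : 0 < s by rewrite ltr_wpDl// !mulr_ge0 ?sqrtr_ge0.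
  have /cvgrPdist_lt/(_ (e / 2 / s))[|N _ hN] := zl; first by rewrite !divr_gt0.
  have := hN N (leqnn N) => /= zN.
  have h n : `|B (y n) (l - z N)| < e / 2.
    apply: (@le_lt_trans _ _ (s * `|l - z N|)); last by rewrite mulrC -ltr_pdivlMr.
    apply: (le_trans (Bxc _ _)); rewrite /c /s mulrDl mul1r ler_wpDr//.
    by rewrite -[leRHS]mulrA ler_wpM2l ?mulr_ge0 ?sqrtr_ge0 ?fnorm_le.
  exists (f (z N)).
  have e20 : 0 < e / 2 by rewrite divr_gt0.
  have /cvgrPdist_lt/(_ _ e20) := fD _ (Dz N); apply: filterS => n /= hn.
  rewrite -ball_normE /=; have := h n; rewrite dotDr dotNr.
  have -> : f (z N) - B (y n) l = (f (z N) - B (y n) (z N)) - (B (y n) l - B (y n) (z N)).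
    by rewrite opprB addrA subrK.
  move=> h'; apply: (le_lt_trans (ler_normB _ _)); lra.
have Dy n : D (y n) by exact: phic.
have DT v : D v.
  have [w Dw hw] : exists2 w, D w & forall u, D u -> B w u = B v u.
    apply: (riesz D (B v) (fnorm B v * Num.sqrt k)) => // [a u u' _ _|u _].
      by rewrite dotDr dotZr.
    by apply: (le_trans (dot_norm_le _ _ _)); rewrite -[leRHS]mulrA ler_wpM2l ?fnorm_ge0 ?fnorm_le.
  by have := Dw; rewrite /D /=; under eq_fun do rewrite dotC hw// dotC.
have [l _ hl] : exists2 l, D l & forall u, D u -> B l u = f u.
  apply: (riesz D f (Num.sqrt k * b * Num.sqrt k)) => // [a u u' Du Du'|u Du].
    by apply: cvg_lim => //; exact: DlinE.
  have cf : `|B (y n) u| @[n --> \oo] --> `|f u| by apply: cvg_norm; exact: fD.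
  apply: (cvgr_to_le cf); apply: nearW => n; apply: (le_trans (Bxc _ _)).
  by rewrite /c -[leRHS]mulrA ler_wpM2l ?mulr_ge0 ?sqrtr_ge0 ?fnorm_le.
by exists l => v; rewrite hl//; exact: fD.
Qed.

End NormEquivalent.

(** * Opial's lemma *)

Lemma cvg_extraction (phi : nat -> nat) :
  (forall n, (n <= phi n)%N) -> phi n @[n --> \oo] --> \oo.
Proof.
by move=> phin A [N _ NA]; exists N => // n Nn; apply: NA; exact: leq_trans (phin n).
Qed.

Section Opial.
Context {R : realType} {H : completeNormedModType R} (B : {dot H for @idfun R}).
Variables (m k : R).
Hypotheses (m_gt0 : 0 < m) (k_ge0 : 0 <= k).
Hypothesis B_norm : forall x, m * `|x| ^+ 2 <= B x x <= k * `|x| ^+ 2.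

Lemma dot_bounded (x : nat -> H) (z : H) (c : R) :
  (forall n, B (x n - z) (x n - z) <= c) -> exists b, forall n, `|x n| <= b.
Proof.
move=> xc; exists (`|z| + Num.sqrt (c / m)) => n.
rewrite -{1}(subrK z (x n)) addrC; apply: (le_trans (ler_normD _ _)); rewrite lerD2l.
rewrite -[leLHS]normr_id -sqrtr_sqr ler_wsqrtr// ler_pdivlMr// mulrC.
by apply: (le_trans _ (xc n)); have /andP[] := B_norm (x n - z).
Qed.

Lemma dot_cvg0 (v : nat -> H) (s : nat -> R) (c : R) :
  (forall n, B (v n) (v n) <= c * s n) -> s n @[n --> \oo] --> 0 ->
  v n @[n --> \oo] --> 0.
Proof.
move=> vs s0; apply: (@cvg_dist_le _ _ _ _ (fun n => Num.sqrt (c / m * s n))) => [n|].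
  rewrite sub0r normrN -[leLHS]normr_id -sqrtr_sqr ler_wsqrtr//.
  rewrite mulrAC ler_pdivlMr// mulrC; apply: le_trans (vs n).
  by have /andP[] := B_norm (v n).
rewrite -[0 in X in _ --> X](@sqrtr0 R).
apply: (continuous_cvg _ (@sqrt_continuous R 0)).
rewrite -[0 in X in _ --> X](mulr0 (c / m)); apply: cvgM => //; exact: cvg_cst.
Qed.

(** Polarisation turns the convergence of the distances to two weak cluster points [l], [l'] into
    convergence of [B (x n) (l - l')]. Its limit equals both [B l (l - l')] and [B l' (l - l')], so
    [l = l']. *)
Lemma opial (x : nat -> H) (Z : set H) : Z !=set0 ->
  (forall z, Z z -> cvgn (fun n => B (x n - z) (x n - z))) ->
  (forall (phi : nat -> nat) l, (forall n, (n <= phi n)%N) ->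
     weakly_cvg B (x \o phi) l -> Z l) ->
  exists2 z, Z z & weakly_cvg B x z.
Proof.
move=> [z0 Zz0] xZ Zcl.
have [b xb] : exists b, forall n, `|x n| <= b.
  have [c [_ /(_ (c + 1)) hc]] := cvg_seq_bounded (xZ _ Zz0).
  apply: (@dot_bounded x z0 (c + 1)) => n.
  by apply: le_trans (ler_norm _) (hc _ _ I); rewrite ltrDl.
have [phi phin [l xl]] := weakly_compact B m k m_gt0 k_ge0 B_norm x b xb.
have Zl : Z l by exact: Zcl xl.
have uniq psi l' : (forall n, (n <= psi n)%N) -> weakly_cvg B (x \o psi) l' -> l = l'.
  move=> psin xl'; have Zl' : Z l' by exact: Zcl xl'.
  have /cvg_ex[g hg] : cvgn (fun n => B (x n) (l - l')).
    have /cvg_ex[/= a1 h1] := xZ _ Zl; have /cvg_ex[/= a2 h2] := xZ _ Zl'.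
    apply/cvg_ex; exists (2^-1 * (a2 - a1 - (B l' l' - B l l))).
    under eq_cvg => n.
      have -> : B (x n) (l - l') = 2^-1 * (B (x n - l') (x n - l') -
          B (x n - l) (x n - l) - (B l' l' - B l l)).
        by rewrite !dotE (dotC B l (x n)) (dotC B l' (x n)); field.
      over.
    by apply: cvgM (cvg_cst _) _; apply: cvgB (cvg_cst _); exact: cvgB.
  have e1 : g = B l (l - l').
    apply: (cvg_unique (@norm_hausdorff _ _) _ (xl (l - l'))).
    exact: cvg_comp (cvg_extraction _ phin) hg.
  have e2 : g = B l' (l - l').
    apply: (cvg_unique (@norm_hausdorff _ _) _ (xl' (l - l'))).
    exact: cvg_comp (cvg_extraction _ psin) hg.
  apply/eqP; rewrite -subr_eq0; apply/eqP/(@dot_eq0 _ _ B).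
  by rewrite dotDl dotNl -e1 -e2 subrr.
(* If the whole sequence failed to converge weakly, some [y] would keep a subsequence at distance
   [e], and a further extraction would give a cluster point other than [l]. *)
exists l => // y; apply/cvgrPdist_lt => e e0; apply: contrapT => nn.
have ex N : exists n, (N <= n)%N /\ e <= `|B l y - B (x n) y|.
  apply: contrapT => h; apply: nn; exists N => // n Nn /=.
  by rewrite ltNge; apply/negP => he; apply: h; exists n.
have [psi hpsi] := choice ex.
have [chi chin [l' xl']] := weakly_compact B m k m_gt0 k_ge0 B_norm (x \o psi) b
  (fun n => xb (psi n)).
have ll' : l = l'.
  apply: (uniq (psi \o chi)) => // n; apply: (leq_trans (chin n)).
  by have [] := hpsi (chi n).
have /cvgrPdist_lt/(_ _ e0)[N _ /(_ N (leqnn N))] := xl' y.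
by rewrite /= ltNge -ll'; have [_ ->] := hpsi (chi N).
Qed.

End Opial.

(** * The inner product induced by [S], and the inverse of [S] *)

Section OperatorForm.
Context {R : realType} {H : completeNormedModType R}.
Variables (ip : {dot H for @idfun R}) (S : {linear H -> H}).
Hypotheses (Hip : induces_norm ip) (Sb : bounded_op S) (Ssa : self_adjoint ip S)
  (Ssm : strongly_monotone ip S).

Lemma op_form : exists B : {dot H for @idfun R}, forall x y, B x y = ip x (S y).
Proof.
pose b x y := ip x (S y).
have b1 u' : zmod_morphism (b ^~ u') by move=> x y; rewrite /b dotDl dotNl.
have b2 u : zmod_morphism (b u) by move=> x y; rewrite /b linearB dotDr dotNr.
have b3 u' : scalable_for *%R (b ^~ u') by move=> a x; rewrite /b dotZl.
have b4 u : scalable_for (idfun \; *%R) (b u) by move=> a x; rewrite /b linearZ dotZr.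
have b5 x y : b x y = (-1) ^+ false * idfun (b y x).
  by rewrite expr0 mul1r /b /= -Ssa dotC.
have b6 u : u != 0 -> 0 < b u u.
  move=> u0; have [m m0 hm] := Ssm; rewrite /b dotC; apply: lt_le_trans (hm u).
  by rewrite mulr_gt0// exprn_gt0// normr_gt0.
pose B1 := isBilinear.Build R H H R _ _ b b1 b2 b3 b4.
pose B2 := isHermitianSesquilinear.Build R H false (@idfun R) b b5.
pose B3 := isDotProduct.Build R H b b6.
by exists (HB.pack_for {dot H for @idfun R} b B1 B2 B3).
Qed.

Lemma ip_fnorm x : fnorm ip x = `|x|.
Proof. by rewrite /fnorm -Hip sqrtr_sqr normr_id. Qed.

Lemma op_form_norm : exists m k : R, [/\ 0 < m, 0 <= k &
  forall x, m * `|x| ^+ 2 <= ip x (S x) <= k * `|x| ^+ 2].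
Proof.
have [m m0 hm] := Ssm; have [k hk] := Sb.
exists m, (Num.max k 0); split => // [|x]; first by rewrite le_max lexx orbT.
rewrite dotC hm/=; apply: (le_trans (dot_le _ _ _)); rewrite !ip_fnorm.
rewrite expr2 mulrA ler_wpM2r//; apply: (le_trans (hk x)).
by rewrite ler_wpM2r// le_max lexx.
Qed.

(** The vector representing [ip y] in the inner product [B] is a preimage of [y], by
    self-adjointness. *)
Lemma op_surj y : exists x, S x = y.
Proof.
have [B hB] := op_form; have [m [k [m0 k0 hn]]] := op_form_norm.
have [||||||x _ hx] := @riesz _ _ B m k m0 k0 _ setT (ip y) `|y|.
- by move=> x; rewrite hB.
- by [].
- by [].
- by [].
- by move=> a u v _ _; rewrite dotDr dotZr.
- by move=> u _; apply: (le_trans (dot_norm_le _ _ _)); rewrite !ip_fnorm.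
exists x; apply/eqP; rewrite -subr_eq0; apply/eqP/(@dot_eq0 _ _ ip).
by rewrite dotDl dotNl -(hx _ I) hB Ssa subrr.
Qed.

Lemma op_inj : injective S.
Proof.
move=> x y Sxy; apply/eqP; rewrite -subr_eq0; apply/eqP.
have [B hB] := op_form; apply: (@dot_eq0 _ _ B).
by rewrite hB linearB Sxy subrr dotC dot0l.
Qed.

Lemma op_invK y : S (inv_op S y) = y.
Proof. by have [x <-] := op_surj y; apply: pinvK; apply: mem_set; exists x. Qed.

Lemma opK x : inv_op S (S x) = x.
Proof. by apply: op_inj; rewrite op_invK. Qed.

Lemma op_inv_linear a x y : inv_op S (a *: x + y) = a *: inv_op S x + inv_op S y.
Proof. by apply: op_inj; rewrite linearP !op_invK. Qed.

End OperatorForm.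

(** * One-step energy estimates and the quadratic forms of the settings *)

Section Energy.
Context {R : realType} {H : lmodType R} (B : {dot H for @idfun R}).
Implicit Types (r u v c w : H) (theta beta tau rho mu zeta eta xi : R).

(* Equals [S^-1 (a + C z)], where [a] is the point of [A p_{n+1}] produced by the
   iteration, [r = x_n - p_{n+1}], [u = U_n], [v = U_{n+1}] and
   [c = S^-1 (C x_n - C z)]. *)
Definition residual (tau : R) r u v c : H := (tau^-1 : R) *: (r + u - v) - c.

Definition decrease (theta beta tau rho : R) r u v c : R :=
  (2 - theta) * B r r + 2 * B r u - 2 * (1 - theta) * B r v +
  2 * tau * (rho * B (residual tau r u v c) (residual tau r u v c) +
             beta * B c c - B c r).

Definition potential (theta : R) w u : R := B w w + 2 * theta * B w u.

Lemma potential_decrease theta beta tau rho mu w r u v c :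
  0 < theta -> 0 < tau ->
  mu * B (w - r) (w - r) + rho * B (residual tau r u v c) (residual tau r u v c)
    <= B (w - r) (residual tau r u v c) ->
  beta * B c c <= B w c ->
  potential theta (w - theta *: r) v +
    theta * (decrease theta beta tau rho r u v c +
             2 * tau * mu * B (w - r) (w - r)) <= potential theta w u.
Proof.
move=> th0 tau0 hA hC; rewrite -subr_ge0.
set G := (X in 0 <= X).
have -> : G = 2 * theta * tau * (B (w - r) (residual tau r u v c) -
    (mu * B (w - r) (w - r) + rho * B (residual tau r u v c) (residual tau r u v c)))
  + 2 * theta * tau * (B w c - beta * B c c).
  rewrite /G /potential /decrease; set e := residual _ _ _ _ _.
  have -> : B (w - r) e = tau^-1 * B (w - r) (r + u - v) - B (w - r) c.
    by rewrite /e /residual [LHS]dotDr dotZr dotNr.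
  move: (B e e) => Bee.
  rewrite !dotE (dotC B r w) (dotC B c r).
  by field; rewrite gt_eqF.
by rewrite addr_ge0// mulr_ge0 ?subr_ge0// !mulr_ge0// ltW.
Qed.

Lemma potential_bounds theta zeta w r u : 0 <= theta -> 0 <= zeta ->
  fnorm B u <= zeta * fnorm B r ->
  `|potential theta w u - B w w| <= theta * zeta * (B w w + B r r).
Proof.
move=> th0 z0 ur; rewrite /potential addrC addKr normrM ger0_norm ?mulr_ge0//.
apply: (@le_trans _ _ (2 * theta * (fnorm B w * (zeta * fnorm B r)))).
  rewrite ler_wpM2l ?mulr_ge0//; apply: (le_trans (dot_norm_le _ _ _)).
  by rewrite ler_wpM2l ?fnorm_ge0.
rewrite -!sqr_fnorm -subr_ge0.
have -> : theta * zeta * (fnorm B w ^+ 2 + fnorm B r ^+ 2) -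
  2 * theta * (fnorm B w * (zeta * fnorm B r)) =
  theta * zeta * (fnorm B w - fnorm B r) ^+ 2 by ring.
by rewrite mulr_ge0 ?sqr_ge0// mulr_ge0.
Qed.

(** The form is [P |r|^2 - 2 Q <r, c> + W |c|^2]. Completing the square in [c] leaves the Schur
    complement [P - Q^2 / W], and multiplied by [W] this is minus the polynomial assumed
    negative. *)
Lemma decrease_exact theta beta tau rho : 0 < tau -> - beta < rho ->
  tau ^+ 2 - 2 * tau * ((2 - theta) * (beta + rho) - 2 * rho) - 4 * rho * beta < 0 ->
  exists2 eps, 0 < eps & forall r c,
    2 * eps * B r r <= decrease theta beta tau rho r 0 0 c.
Proof.
move=> tau0 hrho hq.
pose Q := 2 * rho + tau; pose W := 2 * tau * (beta + rho).
have W0 : 0 < W by rewrite /W; apply: mulr_gt0; lra.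
pose P := 2 - theta + 2 * rho / tau.
have PQ : 0 < P - Q ^+ 2 / W.
  rewrite -(pmulr_lgt0 _ W0).
  have -> : (P - Q ^+ 2 / W) * W = - (tau ^+ 2 - 2 * tau * ((2 - theta) *
    (beta + rho) - 2 * rho) - 4 * rho * beta).
    by rewrite /P /Q /W; field; rewrite !gt_eqF//; lra.
  by rewrite oppr_gt0.
exists ((P - Q ^+ 2 / W) / 2) => [|r c]; first by rewrite divr_gt0.
rewrite -subr_ge0; have := mulr_ge0 (ltW W0) (dot_ge0 B (c - (Q / W : R) *: r)).
congr (0 <= _); rewrite /decrease /residual subr0 !addr0 !dotE !dot0r (dotC B c r).
by rewrite /P /Q /W; field; rewrite !gt_eqF//; lra.
Qed.

Lemma decrease_cocoercive0 theta beta tau rho zeta eta xi : 0 < tau -> rho <= 0 ->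
  0 <= zeta -> 0 <= xi ->
  0 < 2 - theta - 2 * eta * zeta + 2 * rho / tau * (zeta + xi) ^+ 2 ->
  exists kappa eps : R, [/\ 0 < eps, zeta <= kappa & forall r0 r u v,
    fnorm B u <= zeta * fnorm B r0 -> fnorm B (r - v) <= xi * fnorm B r ->
    (1 - theta) * B r v <= (eta - 1) * zeta * B r r ->
    (kappa + eps) * B r r - (kappa - eps) * B r0 r0
      <= decrease theta beta tau rho r u v 0].
Proof.
move=> tau0 rho0 z0 xi0 hpos.
pose eps : R := (2 - theta - 2 * eta * zeta + 2 * rho / tau * (zeta + xi) ^+ 2) / 2.
have [g gE] : exists g : R, g = - rho / tau by exists (- rho / tau).
have g0 : 0 <= g by rewrite gE divr_ge0 ?oppr_ge0// ltW.
have eps0 : 0 < eps by rewrite divr_gt0.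
exists (zeta + 2 * g * zeta * (zeta + xi) + eps), eps; split=> //.
  by rewrite -addrA lerDl addr_ge0 ?(ltW eps0)// !mulr_ge0 ?addr_ge0.
move=> r0 r u v ur vr etav.
rewrite /decrease /residual subr0 !dotZl !dotZr !dot0l.
have [d dE] : exists d, r + u - v = d by exists (r + u - v).
rewrite dE.
have dle : fnorm B d <= xi * fnorm B r + zeta * fnorm B r0.
  have -> : d = (r - v) + u by rewrite -dE addrAC.
  by apply: (le_trans (fnormD B (r - v) u)); exact: lerD.
have Bru : - (fnorm B r * (zeta * fnorm B r0)) <= B r u.
  rewrite lerNl; apply: le_trans (ler_norm _) _; rewrite normrN.
  by apply: (le_trans (dot_norm_le _ _ _)); rewrite ler_wpM2l ?fnorm_ge0.
have Bdd : B d d <= (xi * fnorm B r + zeta * fnorm B r0) ^+ 2.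
  by rewrite -sqr_fnorm ler_pXn2r ?nnegrE ?fnorm_ge0// (le_trans _ dle) ?fnorm_ge0.
have -> : 2 * tau * (rho * (tau^-1 * (tau^-1 * B d d)) + beta * 0 - 0) = - (2 * g * B d d).
  by rewrite gE; field; rewrite gt_eqF.
have gBdd := ler_wpM2l (mulr_ge0 (ler0n R 2) g0) Bdd.
rewrite -!(sqr_fnorm B r) -(sqr_fnorm B r0) in etav *.
have -> : eps = (2 - theta - 2 * eta * zeta - 2 * g * (zeta + xi) ^+ 2) / 2.
  by rewrite /eps gE; field; rewrite gt_eqF.
move: (fnorm B r) (fnorm B r0) Bru etav gBdd => s t Bru etav gBdd.
(* Both Young inequalities at once, for the cross terms of [B r u] and of [B d d]. *)
have st : 0 <= (zeta + 2 * g * xi * zeta) * (s - t) ^+ 2.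
  by rewrite mulr_ge0 ?sqr_ge0// addr_ge0// !mulr_ge0.
lra.
Qed.

(** The constants are crude because the lemma is applied with [rho] close to 0. The estimate
    [|d| <= 2 |r| + |r0|] costs [g (32 |r|^2 + 8 |r0|^2)], where [g = - rho / tau], hence the 40.
    The [|c|^2] part of the residual lowers [beta] to [beta + 2 rho], and completing the square in
    [c] with [beta'] costs [tau / (2 beta')] on [|r|^2]. *)
Lemma decrease_cocoercive theta beta beta' tau rho zeta eta : 0 < tau -> rho <= 0 ->
  0 <= zeta <= 1 -> 0 < beta' <= beta + 2 * rho ->
  0 < 2 - theta - 2 * eta * zeta - tau / (2 * beta') + 40 * rho / tau ->
  exists kappa eps : R, [/\ 0 < eps, zeta <= kappa & forall r0 r u v c,
    fnorm B u <= zeta * fnorm B r0 -> fnorm B v <= zeta * fnorm B r ->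
    (1 - theta) * B r v <= (eta - 1) * zeta * B r r ->
    (kappa + eps) * B r r - (kappa - eps) * B r0 r0
      <= decrease theta beta tau rho r u v c].
Proof.
move=> tau0 rho0 /andP[z0 z1] /andP[b0 hb] hpos.
pose eps : R := (2 - theta - 2 * eta * zeta - tau / (2 * beta') + 40 * rho / tau) / 2.
have [g gE] : exists g : R, g = - rho / tau by exists (- rho / tau).
have g0 : 0 <= g by rewrite gE divr_ge0 ?oppr_ge0// ltW.
have eps0 : 0 < eps by rewrite divr_gt0.
exists (zeta + 8 * g + eps), eps; split=> //.
  by rewrite -addrA lerDl addr_ge0 ?(ltW eps0)// !mulr_ge0 ?addr_ge0.
move=> r0 r u v c ur vr etav.
rewrite /decrease /residual.
have [d dE] : exists d, r + u - v = d by exists (r + u - v).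
rewrite dE.
have r0_ge0 := fnorm_ge0 B r0; have r_ge0 := fnorm_ge0 B r.
have dle : fnorm B d <= 2 * fnorm B r + fnorm B r0.
  rewrite -dE; apply: (le_trans (fnormD _ _ _)); rewrite fnormN.
  have := fnormD B r u; have := ler_piMl r_ge0 z1; have := ler_piMl r0_ge0 z1; lra.
have Bru : - (fnorm B r * (zeta * fnorm B r0)) <= B r u.
  rewrite lerNl; apply: le_trans (ler_norm _) _; rewrite normrN.
  by apply: (le_trans (dot_norm_le _ _ _)); rewrite ler_wpM2l ?fnorm_ge0.
have Bdd : B d d <= (2 * fnorm B r + fnorm B r0) ^+ 2.
  by rewrite -sqr_fnorm ler_pXn2r ?nnegrE ?fnorm_ge0// (le_trans _ dle) ?fnorm_ge0.
have Be : B ((tau^-1 : R) *: d - c) ((tau^-1 : R) *: d - c) <= 2 * tau^-1 ^+ 2 * B d d + 2 * B c c.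
  have := dot_ge0 B ((tau^-1 : R) *: d + c); rewrite !dotE (dotC B c d); lra.
have rBe := ler_wpM2l (mulr_ge0 (mulr_ge0 (ler0n R 2) (ltW tau0))
  (_ : 0 <= - rho)) Be; rewrite oppr_ge0 in rBe; have {}rBe := rBe rho0.
have gBdd := ler_wpM2l (mulr_ge0 (ler0n R 4) g0) Bdd.
have e1 : 2 * tau * - rho * (2 * tau^-1 ^+ 2 * B d d + 2 * B c c) =
  4 * g * B d d - 4 * tau * rho * B c c.
  by rewrite gE; field; rewrite gt_eqF.
have Bcr := mulr_ge0 (mulr_ge0 (ler0n R 2) (ltW tau0))
  (mulr_ge0 (ltW b0) (dot_ge0 B (c - ((2 * beta')^-1 : R) *: r))).
have e2 : 2 * tau * (beta' * B (c - ((2 * beta')^-1 : R) *: r) (c - ((2 * beta')^-1 : R) *: r)) =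
  2 * tau * (beta' * B c c) - 2 * tau * B c r + tau / (2 * beta') * B r r.
  by rewrite !dotE (dotC B r c); field; rewrite gt_eqF.
rewrite e2 in Bcr; rewrite e1 in rBe.
have hbc := ler_wpM2l (mulr_ge0 (mulr_ge0 (ler0n R 2) (ltW tau0)) (dot_ge0 B c)) hb.
have epsE : eps = (2 - theta - 2 * eta * zeta - tau / (2 * beta') - 40 * g) / 2.
  by rewrite /eps gE; field; rewrite !gt_eqF.
rewrite epsE; move: (tau / (2 * beta')) Bcr {e2 epsE eps eps0 hpos} => h Bcr.
rewrite -!(sqr_fnorm B r) -(sqr_fnorm B r0) in etav Bcr *.
move: (fnorm B r) (fnorm B r0) Bru etav gBdd Bcr r_ge0 r0_ge0
  {ur vr dle Bdd} => s t Bru etav gBdd Bcr s0 t0.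
have st : 0 <= zeta * (s - t) ^+ 2 by rewrite mulr_ge0 ?sqr_ge0.
(* Gives [(2 s + t)^2 <= 8 s^2 + 2 t^2]. *)
have st2 : 0 <= g * (2 * s - t) ^+ 2 by rewrite mulr_ge0 ?sqr_ge0.
lra.
Qed.

End Energy.

(** * Descent and geometric decay of real sequences *)

Section RealSequences.
Context {R : realType}.
Implicit Types L s : nat -> R.

Lemma descent_cvg L s (delta : R) : 0 < delta ->
  (forall n, L n.+1 + delta * s n <= L n) -> (forall n, 0 <= L n) ->
  (forall n, 0 <= s n) -> [/\ cvgn L, s n @[n --> \oo] --> 0 & forall n, L n <= L 0].
Proof.
move=> d0 Ld L0 s0.
have Lnincr : nonincreasing_seq L.
  apply/nonincreasing_seqP => n; apply: le_trans (Ld n).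
  by rewrite lerDl mulr_ge0// ltW.
have cL : cvgn L.
  by apply: nonincreasing_is_cvgn => //; exists 0 => _ [n _ <-].
split=> // [|n]; last exact: Lnincr.
apply: (@squeeze_cvgr _ _ _ _ (cst 0) (fun n => delta^-1 * (L n - L n.+1))).
- apply: nearW => n; rewrite /cst s0/= mulrC ler_pdivlMr// mulrC.
  by have := Ld n; lra.
- exact: cvg_cst.
- rewrite -[0 in X in _ --> X](mulr0 delta^-1); apply: cvgM; first exact: cvg_cst.
  rewrite -(subrr (limn L)); apply: cvgB => //.
  by rewrite (cvg_shiftS L).
Qed.

Lemma geometric_le L (q : R) : 0 <= q -> (forall n, L n.+1 <= q * L n) ->
  forall n, L n <= q ^+ n * L 0.
Proof.
move=> q0 Lq; elim=> [|n IH]; first by rewrite expr0 mul1r.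
by apply: (le_trans (Lq n)); rewrite exprS -mulrA ler_wpM2l.
Qed.

End RealSequences.

(** * Consequences of the Lyapunov descent *)

Section Lyapunov.
Context {R : realType} {H : completeNormedModType R} (B : {dot H for @idfun R}).
Variables (m k : R).
Hypotheses (m_gt0 : 0 < m) (k_ge0 : 0 <= k).
Hypothesis B_norm : forall x, m * `|x| ^+ 2 <= B x x <= k * `|x| ^+ 2.
Variables (theta zeta kappa eps nu : R) (x p U : nat -> H) (z : H).
Hypotheses (theta_itv : 0 < theta < 2) (zeta_itv : 0 <= zeta < 2^-1).
Hypotheses (zeta_kappa : zeta <= kappa) (eps_gt0 : 0 < eps) (nu_ge0 : 0 <= nu).

Let r n : H := x n - p n.+1.

Hypothesis U_le : forall n, fnorm B (U n.+1) <= zeta * fnorm B (r n).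
Hypothesis potential_le : forall n,
  potential B theta (x n.+2 - z) (U n.+2) +
    theta * ((kappa + eps) * B (r n.+1) (r n.+1) - (kappa - eps) * B (r n) (r n)) +
    nu * B (p n.+2 - z) (p n.+2 - z) <= potential B theta (x n.+1 - z) (U n.+1).

(** The shift by one reflects that [U 0] is unconstrained: only [U n.+1] is bounded, through
    [r n]. *)
Definition lyapunov n : R :=
  potential B theta (x n.+1 - z) (U n.+1) + theta * kappa * B (r n) (r n).

Let theta_ge0 : 0 <= theta.
Proof. by case/andP: theta_itv => /ltW. Qed.

Let zeta_ge0 : 0 <= zeta.
Proof. by case/andP: zeta_itv. Qed.

Let kappa_ge0 : 0 <= kappa.
Proof. exact: le_trans zeta_kappa. Qed.

Let theta_zeta : 0 < 1 - theta * zeta.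
Proof. by move: theta_itv zeta_itv => /andP[? ?] /andP[? ?]; nra. Qed.

Lemma lyapunov_decr n : lyapunov n.+1 +
    theta * eps * (B (r n.+1) (r n.+1) + B (r n) (r n)) +
    nu * B (p n.+2 - z) (p n.+2 - z) <= lyapunov n.
Proof. by rewrite /lyapunov; have := potential_le n; lra. Qed.

Lemma lyapunov_ge n :
  (1 - theta * zeta) * B (x n.+1 - z) (x n.+1 - z) <= lyapunov n.
Proof.
have := potential_bounds B theta zeta (x n.+1 - z) (r n) (U n.+1)
  theta_ge0 zeta_ge0 (U_le n).
rewrite ler_norml /lyapunov => /andP[h _].
have := ler_wpM2l (mulr_ge0 theta_ge0 (dot_ge0 B (r n))) zeta_kappa; lra.
Qed.

Lemma lyapunov_le n : lyapunov n <= (1 + theta * zeta) * B (x n.+1 - z) (x n.+1 - z)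
  + theta * (zeta + kappa) * B (r n) (r n).
Proof.
have := potential_bounds B theta zeta (x n.+1 - z) (r n) (U n.+1)
  theta_ge0 zeta_ge0 (U_le n).
by rewrite ler_norml /lyapunov => /andP[_ h]; lra.
Qed.

Lemma lyapunov_ge0 n : 0 <= lyapunov n.
Proof.
by apply: le_trans (lyapunov_ge n); rewrite mulr_ge0 ?dot_ge0// ltW.
Qed.

Lemma lyapunov_cvg : [/\ cvgn lyapunov, B (r n) (r n) @[n --> \oo] --> 0 &
  forall n, lyapunov n <= lyapunov 0].
Proof.
pose s n := B (r n.+1) (r n.+1) + B (r n) (r n).
have d0 : 0 < theta * eps by rewrite mulr_gt0//; case/andP: theta_itv.
have Ls n : lyapunov n.+1 + theta * eps * s n <= lyapunov n.
  by apply: le_trans (lyapunov_decr n); rewrite lerDl mulr_ge0 ?dot_ge0.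
have s_ge0 n : 0 <= s n by rewrite addr_ge0 ?dot_ge0.
have [cL s0 Lle] := descent_cvg lyapunov s (theta * eps) d0 Ls lyapunov_ge0 s_ge0.
split=> //; apply: (@squeeze_cvgr _ _ _ _ (cst 0) _ _ _ _ _ s0); last exact: cvg_cst.
by apply: nearW => n; rewrite /cst dot_ge0/= lerDr dot_ge0.
Qed.

(** The squared distance differs from the convergent Lyapunov function by terms that vanish with
    [r n]; in the cross term [x n.+1 - z] stays bounded and [U n.+1] is at most [zeta] times
    [r n]. *)
Lemma fejer_cvg : cvgn (fun n => B (x n - z) (x n - z)).
Proof.
have [/cvg_ex[/= l Ll] r0 Lle] := lyapunov_cvg.
apply/cvg_ex; exists (l - theta * kappa * 0 - 2 * theta * 0).
rewrite -(cvg_shiftS (fun n => B (x n - z) (x n - z))).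
have -> : [sequence B (x n.+1 - z) (x n.+1 - z)]_n = (fun n => lyapunov n -
    theta * kappa * B (r n) (r n) - 2 * theta * B (x n.+1 - z) (U n.+1)).
  by apply/funext => n; rewrite /lyapunov /potential /=; ring.
apply: cvgB; first by apply: cvgB => //; apply: cvgM => //; exact: cvg_cst.
apply: cvgM; first exact: cvg_cst.
pose c := Num.sqrt (lyapunov 0 / (1 - theta * zeta)).
have fr0 : c * (zeta * fnorm B (r n)) @[n --> \oo] --> 0.
  rewrite -[0 in X in _ --> X](mulr0 (c * zeta)).
  under eq_cvg do rewrite mulrA.
  apply: cvgM; first exact: cvg_cst.
  rewrite -[0 in X in _ --> X](@sqrtr0 R).
  exact: (continuous_cvg _ (@sqrt_continuous R 0)) r0.
apply: cvg_dist_le fr0 => n; rewrite sub0r normrN.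
apply: (le_trans (dot_norm_le _ _ _)); apply: ler_pM; rewrite ?fnorm_ge0//.
rewrite /c /fnorm ler_wsqrtr// ler_pdivlMr// mulrC.
exact: le_trans (lyapunov_ge n) (Lle n).
Qed.

Lemma linear_cvg : 0 < nu -> R_linear_cvg x z.
Proof.
move=> nu0; have theta_gt0 : 0 < theta by case/andP: theta_itv.
pose c : R := Num.min (theta * eps) nu.
pose K : R := 2 * (1 + theta * zeta) + theta * (zeta + kappa).
have tz0 : 0 <= theta * zeta by rewrite mulr_ge0.
have tzk0 : 0 <= theta * (zeta + kappa) by rewrite mulr_ge0// addr_ge0.
have K0 : 0 < K by rewrite /K; lra.
have c0 : 0 < c by rewrite lt_min nu0 mulr_gt0.
(* The maximum with 1/2 keeps the rate positive even if [c / K >= 1]. *)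
pose q : R := Num.max (1 - c / K) 2^-1.
have q0 : 0 < q by rewrite lt_max invr_gt0 ltr0n orbT.
have q1 : q < 1 by rewrite gt_max; apply/andP; split; [rewrite ltrBlDr ltrDl divr_gt0|lra].
(* [X] gathers the three dissipated squares. It controls [x n.+1 - z = r n.+1 + (p n.+2 - z)], hence
   [lyapunov n] up to the factor [K]. *)
have Lq n : lyapunov n.+1 <= q * lyapunov n.
  pose X := B (r n.+1) (r n.+1) + B (r n) (r n) + B (p n.+2 - z) (p n.+2 - z).
  have r1_ge0 := dot_ge0 B (r n.+1); have r_ge0 := dot_ge0 B (r n).
  have p_ge0 := dot_ge0 B (p n.+2 - z).
  have wpr : B (x n.+1 - z) (x n.+1 - z) <=
      2 * B (r n.+1) (r n.+1) + 2 * B (p n.+2 - z) (p n.+2 - z).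
    have -> : x n.+1 - z = r n.+1 + (p n.+2 - z) by rewrite /r addrA subrK.
    have := dot_ge0 B (r n.+1 - (p n.+2 - z)).
    move: (r n.+1) (p n.+2 - z) => a b; rewrite !dotE (dotC B b a); lra.
  have LX : lyapunov n <= K * X.
    apply: (le_trans (lyapunov_le n)).
    have h1 : 0 <= 1 + theta * zeta by lra.
    have := ler_wpM2l h1 wpr; have := mulr_ge0 tzk0 r1_ge0.
    have := mulr_ge0 tzk0 p_ge0; have := mulr_ge0 h1 r_ge0.
    by rewrite /K /X; lra.
  have LcX : lyapunov n.+1 + c * X <= lyapunov n.
    apply: le_trans (lyapunov_decr n); rewrite /X mulrDr addrA.
    have cl : c <= theta * eps by rewrite ge_min lexx.
    have cr : c <= nu by rewrite ge_min lexx orbT.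
    by apply: lerD; [rewrite lerD2l|]; rewrite ler_wpM2r// addr_ge0.
  apply: (@le_trans _ _ ((1 - c / K) * lyapunov n)).
    have : c / K * lyapunov n <= c * X.
      by rewrite mulrAC -mulrA -ler_pdivlMl// mulrA mulVf ?gt_eqF// mul1r ler_pdivrMr// mulrC.
    lra.
  by rewrite ler_wpM2r ?lyapunov_ge0// le_max lexx.
pose D := Num.sqrt (lyapunov 0 / ((1 - theta * zeta) * m)).
have tzm0 : 0 < (1 - theta * zeta) * m by rewrite mulr_gt0.
have sq0 : 0 < Num.sqrt q by rewrite sqrtr_gt0.
have xD n : `|x n.+1 - z| <= D * Num.sqrt q ^+ n.
  have -> : Num.sqrt q ^+ n = Num.sqrt (q ^+ n).
    elim: n => [|n IH]; first by rewrite !expr0 sqrtr1.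
    by rewrite !exprS IH sqrtrM// ltW.
  rewrite -[leLHS]normr_id -sqrtr_sqr /D -sqrtrM ?divr_ge0 ?lyapunov_ge0 ?(ltW tzm0)//.
  rewrite ler_wsqrtr// mulrAC ler_pdivlMr// (mulrC (lyapunov 0)).
  apply: le_trans (geometric_le lyapunov q (ltW q0) Lq n).
  apply: le_trans (lyapunov_ge n); rewrite mulrC -mulrA ler_wpM2l ?(ltW theta_zeta)//.
  by have /andP[] := B_norm (x n.+1 - z).
(* The Lyapunov bound is on squared distances, so the rate is the root of [q]. It starts at [x 1]:
   [x 0] is covered by the maximum, and dividing [D] by the rate absorbs the shift. *)
exists (Num.max `|x 0 - z| (D / Num.sqrt q)), (Num.sqrt q); split.
- by rewrite le_max normr_ge0.
- by rewrite sq0/= -(@sqrtr1 R) ltr_sqrt.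
- case=> [|n]; first by rewrite expr0 mulr1 le_max lexx.
  apply: (le_trans (xD n)); rewrite exprS mulrA ler_wpM2r ?exprn_ge0 ?(ltW sq0)//.
  by rewrite -ler_pdivrMr// le_max lexx orbT.
Qed.

End Lyapunov.

(** * The assumptions read in the inner product [B] *)

Section Main.
Context {R : realType} {H : completeNormedModType R}.
Variables (ip B : {dot H for @idfun R}) (S : {linear H -> H}).
Variables (A : H -> set H) (C M : H -> H) (beta rho zeta tau : R).
Hypotheses (Hip : induces_norm ip) (BE : forall x y, B x y = ip x (S y)).
Hypothesis Hst : standing_assumptions ip S A C M beta rho zeta tau.

Local Notation T := (inv_op S).
Local Notation K := (tauM_sub_S S M tau).
Local Notation rh := (rho_hat rho).

Let Sb := S_bounded Hst.
Let Ssa := S_self_adjoint Hst.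
Let Ssm := S_strongly_monotone Hst.

Let TK y : S (T y) = y.
Proof. exact: (op_invK ip). Qed.

Let SK x : T (S x) = x.
Proof. exact: (opK ip). Qed.

Let TP a x y : T (a *: x + y) = a *: T x + T y.
Proof. exact: (op_inv_linear ip). Qed.

Let T0 : T 0 = 0.
Proof. by have := SK 0; rewrite linear0. Qed.

Lemma ip_op_inv w v : ip w v = B w (T v).
Proof. by rewrite BE TK. Qed.

Lemma norm_wrt_op x : norm_wrt ip S x = fnorm B x.
Proof. by rewrite /norm_wrt /sqnorm_wrt -BE. Qed.

Lemma sqnorm_wrt_op_inv v : sqnorm_wrt ip T v = B (T v) (T v).
Proof. by rewrite /sqnorm_wrt dotC ip_op_inv. Qed.

Lemma norm_wrt_op_inv v : norm_wrt ip T v = fnorm B (T v).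
Proof. by rewrite /norm_wrt sqnorm_wrt_op_inv. Qed.

Lemma cocoercive_op x y :
  beta * B (T (C x - C y)) (T (C x - C y)) <= B (x - y) (T (C x - C y)).
Proof.
by have := C_cocoercive Hst x y; rewrite sqnorm_wrt_op_inv ip_op_inv.
Qed.

Lemma kernel_lip x y : fnorm B (T (K x - K y)) <= zeta * fnorm B (y - x).
Proof.
have := kernel_lipschitz Hst x y.
by rewrite norm_wrt_op_inv norm_wrt_op -(opprB x y) fnormN.
Qed.

(** With [y = p_{n+1}] the left side is [r_n - U_{n+1}]; this is how the modulus of [M], and thus
    [xi], enters the estimates. *)
Lemma tauM_op x y : x - y - T (K y - K x) = tau *: T (M x - M y).
Proof.
have -> : K y - K x = (- tau) *: (M x - M y) + S (x - y).
  rewrite /tauM_sub_S (linearB S) scaleNr scalerBr !opprB.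
  by rewrite [S x - _]addrC addrACA [- S y + _]addrC.
by rewrite TP SK scaleNr opprD opprK addrCA subrr addr0.
Qed.

(* [(mu S, r S^-1)]-semimonotonicity of [A] on [zer_pairs A C], read in the inner
   product [B]. *)
Definition regular (mu r : R) : Prop := forall z p a, zer_sum A C z -> A p a ->
  mu * B (p - z) (p - z) + r * B (T (a + C z)) (T (a + C z))
    <= B (p - z) (T (a + C z)).

Lemma semimonotone_regular (N : H -> H) mu : (forall h, ip h (N h) = mu * B h h) ->
  semimonotone_on ip (zer_pairs A C) N (fun h => rho *: T h) A -> regular mu rho.
Proof.
move=> hN sA z p a Zz pa.
have := sA z (- C z) p a (conj Zz erefl) pa.
by rewrite opprK hN dotZr (ip_op_inv (p - z)) (dotC ip (a + C z)) ip_op_inv.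
Qed.

Lemma regular_comonotone : regular 0 rho.
Proof.
by apply: (semimonotone_regular (fun=> 0)); [move=> h; rewrite dot0r mul0r|exact: A_comonotone Hst].
Qed.

Lemma regular_semimonotone mu : semimonotone_on ip (zer_pairs A C)
  (fun h => mu *: S h) (fun h => rho *: T h) A -> regular mu rho.
Proof. by apply: semimonotone_regular => h; rewrite dotZr -BE. Qed.

Lemma regular_le mu r r' : r' <= r -> regular mu r -> regular mu r'.
Proof.
move=> rr hr z p a Zz pa; apply: le_trans (hr z p a Zz pa).
by rewrite lerD2l ler_wpM2r ?dot_ge0.
Qed.

Lemma zer_sumP z : zer_sum A C z -> A z (- C z).
Proof. by case=> a Aza [b /= -> /eqP]; rewrite addr_eq0 => /eqP <-. Qed.

Lemma rh_le0 : rh <= 0. Proof. by rewrite ge_min lexx orbT. Qed.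

Lemma rh_le : rh <= rho. Proof. by rewrite ge_min lexx. Qed.

Lemma rh_gt : - beta < rh.
Proof. by rewrite lt_min (rho_gt Hst) oppr_lt0 (beta_gt0 Hst). Qed.

Let zeta_itv : 0 <= zeta < 2^-1. Proof. exact: zeta_bounds Hst. Qed.

Let zeta_ge0 : 0 <= zeta. Proof. by case/andP: zeta_itv. Qed.

(** * The three settings *)

Section Theta.
Variable theta : R.
Hypothesis theta_itv : 0 < theta < 2.
Local Notation eta := (eta_of ip S M tau theta).

Lemma eta_ge1 : 1 <= eta.
Proof. by rewrite /eta_of; case: ifP => // _; rewrite lerDl. Qed.

(** When [S - tau M] is monotone and [theta >= 1], the product has a sign and the left side is at
    most 0, which [eta = 1] records. Otherwise Cauchy-Schwarz and the Lipschitz constant cost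
    [|1 - theta| zeta]. *)
Lemma eta_bound x p : (1 - theta) * B (x - p) (T (K p - K x)) <=
  (eta - 1) * zeta * B (x - p) (x - p).
Proof.
rewrite /eta_of; case: ifP => [/andP[/andP[th1 _] /asboolP mono]|_].
  rewrite subrr !mul0r mulr_le0_ge0 ?subr_le0// -ip_op_inv.
  have -> : K p - K x = (S x - tau *: M x) - (S p - tau *: M p).
    by rewrite /tauM_sub_S !opprB addrC.
  by have := mono (x, S x - tau *: M x) (p, S p - tau *: M p) erefl erefl.
rewrite [1 + `|_|]addrC addrK; apply: (le_trans (ler_norm _)).
rewrite normrM -mulrA ler_wpM2l//; apply: (le_trans (dot_norm_le _ _ _)).
rewrite -(sqr_fnorm B (x - p)) expr2 mulrCA ler_wpM2l ?fnorm_ge0//.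
exact: kernel_lip.
Qed.

(** The pairs [(x0, p0)] and [(x1, p1)] stand for two consecutive pairs [(x_n, p_{n+1})]. *)
Definition decrease_bound (r kappa eps : R) : Prop := forall x0 p0 x1 p1 z,
  (kappa + eps) * B (x1 - p1) (x1 - p1) - (kappa - eps) * B (x0 - p0) (x0 - p0)
    <= decrease B theta beta tau r (x1 - p1) (T (K p0 - K x0)) (T (K p1 - K x1))
         (T (C x1 - C z)).

(* The comonotonicity constant [r] used in the descent is [rho_hat] in settings
   (i) and (ii).  In (iii) it is slightly negative: mixing monotonicity with a
   small multiple of [(mu S, rho S^-1)]-semimonotonicity costs only that much,
   whatever [rho] is. *)
Definition admissible : Prop := exists r kappa eps : R,
  [/\ [/\ 0 < eps, zeta <= kappa & 0 < tau], decrease_bound r kappa eps,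
      regular 0 r & forall mu, 0 < mu -> regular mu rho ->
        exists2 mu', 0 < mu' & regular mu' r].

Let regular_rh mu : regular mu rho -> regular mu rh.
Proof. exact: regular_le rh_le. Qed.

Lemma setting_i_admissible theta_bar t1 t2 :
  setting_i S M beta rho zeta tau theta theta_bar t1 t2 ->
  t1 < tau -> (tau%:E < t2)%E -> admissible.
Proof.
rewrite /setting_i; set b := (2 - theta) * (beta + rh) - 2 * rh.
move=> [[KS z0] _ -> ->]; rewrite lte_fin; set D := b ^+ 2 + 4 * rh * beta => lo hi.
have := rh_le0; have := rh_gt => rhgt rhle; have b0 := beta_gt0 Hst.
(* For [D <= 0] the root is 0 by default and the interval for [tau] would be empty. *)
have D0 : 0 < D by rewrite -sqrtr_gt0; lra.
have b_ge0 : 0 <= b.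
  have : 0 <= (2 - theta) * (beta + rh).
    by case/andP: theta_itv => _ ?; apply: mulr_ge0; lra.
  by rewrite /b; lra.
(* Since [rh <= 0], [D <= b^2]; so [t1 >= 0] and [tau] is positive. *)
have Db : Num.sqrt D <= b.
  rewrite -[leRHS]ger0_norm// -sqrtr_sqr ler_wsqrtr// /D gerDl.
  by rewrite mulr_le0_ge0 ?(ltW b0)// mulr_ge0_le0.
have tau0 : 0 < tau by lra.
have [eps eps0 he] : exists2 eps, 0 < eps & forall r c,
    2 * eps * B r r <= decrease B theta beta tau rh r 0 0 c.
  apply: decrease_exact => //.
  have -> : tau ^+ 2 - 2 * tau * ((2 - theta) * (beta + rh) - 2 * rh) - 4 * rh * beta =
    (tau - b) ^+ 2 - Num.sqrt D ^+ 2.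
    by rewrite sqr_sqrtr ?(ltW D0)// /D /b; ring.
  have -> : (tau - b) ^+ 2 - Num.sqrt D ^+ 2 =
    - ((tau - (b - Num.sqrt D)) * (b + Num.sqrt D - tau)) by ring.
  by rewrite oppr_lt0 mulr_gt0// subr_gt0.
exists rh, eps, eps; split.
- by split=> //; rewrite z0 ltW.
- move=> x0 p0 x1 p1 z.
  have K0 x : K x = 0 by rewrite /tauM_sub_S KS subrr.
  rewrite !K0 !subrr T0 mul0r subr0; apply: le_trans (he _ _).
  by rewrite mulr_natl mulr2n.
- exact/regular_rh/regular_comonotone.
- by move=> mu mu0 /regular_rh; exists mu.
Qed.

Lemma setting_ii_admissible zetaM xi theta_bar t1 t2 :
  lipschitzian_wrt ip S zetaM M -> 0 <= zetaM -> xi = tau * zetaM ->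
  setting_ii ip S C M rho zeta tau theta xi theta_bar t1 t2 ->
  t1 < tau -> (tau%:E < t2)%E -> admissible.
Proof.
move=> Mlip zM0 xiE [C0 _ zlt -> _] lo _.
have rhle := rh_le0; have e1 := eta_ge1.
have e4 : 0 < 2 * (eta - 4 * rh) by lra.
have Dn : 0 < 2 - theta - 2 * (eta - 4 * rh) * zeta.
  by move: zlt; rewrite ltr_pdivlMr//; lra.
have num0 : 0 <= - 2 * rh * (zeta + xi) ^+ 2.
  by apply: mulr_ge0; [lra|exact: sqr_ge0].
have tau0 : 0 < tau by apply: le_lt_trans lo; rewrite divr_ge0// ltW.
have xi0 : 0 <= xi by rewrite xiE mulr_ge0// ltW.
have rz : rh * zeta <= 0 by rewrite mulr_le0_ge0.
(* The term [8 * rh * zeta] in the denominator of [t1] is nonpositive, so [t1 < tau] gives at least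
   this inequality. *)
have hpos : 0 < 2 - theta - 2 * eta * zeta + 2 * rh / tau * (zeta + xi) ^+ 2.
  rewrite -(pmulr_rgt0 _ tau0).
  have -> : tau * (2 - theta - 2 * eta * zeta + 2 * rh / tau * (zeta + xi) ^+ 2) =
    tau * (2 - theta - 2 * (eta - 4 * rh) * zeta) + tau * (- 8 * (rh * zeta))
    - (- 2 * rh * (zeta + xi) ^+ 2) by field; rewrite gt_eqF.
  move: lo; rewrite ltr_pdivrMr// => lo.
  have : 0 <= tau * (- 8 * (rh * zeta)) by apply: mulr_ge0; [exact: ltW|lra].
  lra.
have [kappa [eps [eps0 zk he]]] :=
  decrease_cocoercive0 B theta beta tau rh zeta eta xi tau0 rhle zeta_ge0 xi0 hpos.
exists rh, kappa, eps; split => //.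
- move=> x0 p0 x1 p1 z; rewrite !C0 subrr T0; apply: he.
  + exact: kernel_lip.
  + rewrite tauM_op fnormZ ?(ltW tau0)//.
    rewrite xiE -mulrA ler_wpM2l ?(ltW tau0)//.
    by have := Mlip x1 p1; rewrite norm_wrt_op_inv norm_wrt_op.
  + exact: eta_bound.
- exact/regular_rh/regular_comonotone.
- by move=> mu mu0 /regular_rh; exists mu.
Qed.

Lemma setting_iii_admissible theta_bar t1 t2 :
  setting_iii ip S A M beta zeta tau theta theta_bar t1 t2 ->
  t1 < tau -> (tau%:E < t2)%E -> admissible.
Proof.
move=> [Amono _ zlt -> ->] tau0; rewrite lte_fin => hi.
have b0 := beta_gt0 Hst.
have [D DE] : exists D, D = 2 - theta - 2 * eta * zeta by eexists.
have D0 : 0 < D.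
  have : 0 < 2 * beta * D by rewrite DE; exact: lt_trans hi.
  by rewrite pmulr_rgt0// mulr_gt0.
(* The upper bound on [tau] is strict, so [beta] can be lowered a little; the room [beta - b'] pays
   for the negative constant [- e]. *)
have [b' [b'0 b'lt tb']] : exists b', [/\ 0 < b', b' < beta & tau / (2 * b') < D].
  have tD : tau / (2 * D) < beta.
    by rewrite ltr_pdivrMr ?mulr_gt0//; rewrite -DE in hi; lra.
  have tD0 : 0 < tau / (2 * D) by rewrite divr_gt0// mulr_gt0.
  have [b' h1 h2] : exists2 b', tau / (2 * D) < b' & b' < beta.
    by exists ((tau / (2 * D) + beta) / 2); lra.
  have b'0 : 0 < b' by exact: lt_trans h1.
  exists b'; split => //; rewrite ltr_pdivrMr ?mulr_gt0//.
  by move: h1; rewrite ltr_pdivrMr ?mulr_gt0//; lra.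
have [g gE] : exists g, g = D - tau / (2 * b') by eexists.
have g0 : 0 < g by rewrite gE subr_gt0.
(* The 80 spends at most half of the gap [g] on the loss [40 * e / tau]. *)
have [e [e0 e1 e2]] : exists e, [/\ 0 < e, e <= (beta - b') / 2 & e <= g * tau / 80].
  exists (Num.min ((beta - b') / 2) (g * tau / 80)); split.
  - by rewrite lt_min !divr_gt0 ?mulr_gt0 ?subr_gt0.
  - by rewrite ge_min lexx.
  - by rewrite ge_min lexx orbT.
have reg_pos z p a : zer_sum A C z -> A p a -> 0 <= B (p - z) (T (a + C z)).
  move=> /zer_sumP Zz pa; have := Amono (p, a) (z, - C z) pa Zz.
  by rewrite /= opprK ip_op_inv.
have hpos : 0 < 2 - theta - 2 * eta * zeta - tau / (2 * b') + 40 * (- e) / tau.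
  rewrite -DE -gE -(pmulr_rgt0 _ tau0).
  have -> : tau * (g + 40 * - e / tau) = g * tau - 40 * e by field; rewrite gt_eqF.
  by have := mulr_gt0 g0 tau0; lra.
have z1 : 0 <= zeta <= 1 by case/andP: zeta_itv => ->/= ?; lra.
have ne0 : - e <= 0 by lra.
have b'le : 0 < b' <= beta + 2 * - e by rewrite b'0/=; lra.
have [kappa [eps [eps0 zk he]]] :=
  decrease_cocoercive B theta beta b' tau (- e) zeta eta tau0 ne0 z1 b'le hpos.
exists (- e), kappa, eps; split => //.
- move=> x0 p0 x1 p1 z; apply: he; last exact: eta_bound.
  + exact: kernel_lip.
  + exact: kernel_lip.
- move=> z p a Zz pa; rewrite mul0r add0r; apply: le_trans (reg_pos z p a Zz pa).
  by rewrite mulr_le0_ge0 ?dot_ge0.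
move=> mu mu0 hreg.
(* [s] is the weight of semimonotonicity in the mixture, and [1 - s] that of monotonicity. *)
have [s [s0 s1 se]] : exists s, [/\ 0 < s, s <= 1 & - e <= s * rho].
  have r1 : 0 < `|rho| + 1 by rewrite ltr_wpDl.
  exists (Num.min 1 (e / (`|rho| + 1))); split.
  - by rewrite lt_min ltr01 divr_gt0.
  - by rewrite ge_min lexx.
  set s := Num.min _ _; have s0 : 0 <= s by rewrite le_min ler01 divr_ge0 ?(ltW e0) ?(ltW r1).
  have : s * (`|rho| + 1) <= e by rewrite -ler_pdivlMr// ge_min lexx orbT.
  have : - (s * rho) <= s * `|rho|.
    by rewrite -mulrN ler_wpM2l// -normrN ler_norm.
  lra.
exists (s * mu) => [|z p a Zz pa]; first by rewrite mulr_gt0.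
have h1 := ler_wpM2l (ltW s0) (hreg z p a Zz pa).
have h2 := ler_piMl (reg_pos z p a Zz pa) s1.
have h3 := ler_wpM2r (dot_ge0 B (T (a + C z))) se.
lra.
Qed.


(** * The generated sequences: descent and weak cluster points *)

Section Iteration.
Variables (x u p : nat -> H).
Hypothesis Hgen : generated S A C M tau theta x u p.
Hypothesis tau_gt0 : 0 < tau.

Let r n := x n - p n.+1.
Let U n := T (u n).

Lemma iterate_step n : x n.+1 = x n - theta *: r n.
Proof.
have [_ _ ->] := Hgen n.
by rewrite scalerBl scale1r scalerBr opprB -addrA [- _ + _]addrC.
Qed.

Lemma U_lip n : fnorm B (U n.+1) <= zeta * fnorm B (r n).
Proof. by rewrite /U; have [_ -> _] := Hgen n; exact: kernel_lip. Qed.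

(** The element of [A p_{n+1}] supplied by the resolvent, with [M] eliminated by means of
    [u_{n+1}]. *)
Definition iterate_image n : H := (tau^-1 : R) *: (S (r n) + u n - u n.+1) - C (x n).

Lemma iterate_imageP n : A (p n.+1) (iterate_image n).
Proof.
have [[_ -> [a pa aE]] uE _] := Hgen n; suff -> : iterate_image n = a by [].
have {aE} -> : a = M (x n) - C (x n) + tau^-1 *: u n - M (p n.+1).
  by rewrite -aE addrC addKr.
have -> : iterate_image n = (tau^-1 : R) *: (u n + tau *: (M (x n) - M (p n.+1))) - C (x n).
  rewrite /iterate_image uE /tauM_sub_S /r (linearB S) (scalerBr tau).
  move: (S (x n)) (S (p n.+1)) (tau *: M (x n)) (tau *: M (p n.+1)) => sx sp mx mp.
  rewrite [sx - sp + _]addrC -(addrA (u n)) !opprB.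
  by rewrite (addrCA (sx - sp)) (addrA (sx - sp)) (subrK sp sx) (addrA (mx - sx)) subrK.
rewrite scalerDr scalerA mulVf ?gt_eqF// scale1r.
by rewrite [in RHS](addrC (M _ - C _)) -!addrA [- C _ - _]addrC.
Qed.

Lemma image_residual n z :
  T (iterate_image n + C z) = residual tau (r n) (U n) (U n.+1) (T (C (x n) - C z)).
Proof.
rewrite -[RHS]SK; congr T; rewrite /residual /iterate_image /U; move: (r n) => v.
rewrite (linearB S) (linearZ_LR S) (linearB S) (linearD S).
by rewrite !TK opprB -addrA [- C _ + _]addrC.
Qed.

Section Descent.
Variables (rho' kappa eps mu : R).
Hypotheses (hdecr : decrease_bound rho' kappa eps) (hreg : regular mu rho').

Lemma potential_iterate n z : zer_sum A C z ->
  potential B theta (x n.+2 - z) (U n.+2) +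
    theta * ((kappa + eps) * B (r n.+1) (r n.+1) - (kappa - eps) * B (r n) (r n)) +
    2 * theta * tau * mu * B (p n.+2 - z) (p n.+2 - z)
  <= potential B theta (x n.+1 - z) (U n.+1).
Proof.
move=> Zz; have theta_gt0 : 0 < theta by case/andP: theta_itv.
have wr : x n.+1 - z - r n.+1 = p n.+2 - z by rewrite /r opprB addrC addrA subrK.
have h := hreg _ _ _ Zz (iterate_imageP n.+1).
rewrite image_residual -wr in h.
have := potential_decrease B theta beta tau rho' mu (x n.+1 - z) (r n.+1) (U n.+1)
  (U n.+2) (T (C (x n.+1) - C z)) theta_gt0 tau_gt0 h (cocoercive_op _ _).
have -> : x n.+1 - z - theta *: r n.+1 = x n.+2 - z by rewrite [x n.+2]iterate_step addrAC.
rewrite wr.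
have := hdecr (x n) (p n.+1) (x n.+1) (p n.+2) z.
have -> : T (K (p n.+1) - K (x n)) = U n.+1 by rewrite /U; have [_ -> _] := Hgen n.
have -> : T (K (p n.+2) - K (x n.+1)) = U n.+2 by rewrite /U; have [_ -> _] := Hgen n.+1.
move=> /(ler_wpM2l (ltW theta_gt0)); rewrite -/(r n) -/(r n.+1) => h1 h2.
by apply: le_trans h2; rewrite [in leRHS]mulrDr; lra.
Qed.

End Descent.

Section Convergence.
Variables (m k : R).
Hypotheses (m_gt0 : 0 < m) (k_ge0 : 0 <= k).
Hypothesis B_norm : forall v, m * `|v| ^+ 2 <= B v v <= k * `|v| ^+ 2.

(** The inclusion holds at [p_{n+1}], which has the same weak limits as [x_n] because [r n] tends to
    0. There [A + C] contains a vector tending strongly to 0, and the closed graph concludes. *)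
Lemma weak_cluster_zer (phi : nat -> nat) l : B (r n) (r n) @[n --> \oo] --> 0 ->
  (forall n, (n <= phi n)%N) -> weakly_cvg B (x \o phi) l -> zer_sum A C l.
Proof.
move=> Br0 phin xl.
have phioo := cvg_extraction _ phin.
have r0 : r n @[n --> \oo] --> 0.
  by apply: (dot_cvg0 B m k m_gt0 B_norm r _ 1 _ Br0) => n; rewrite mul1r.
have U1 : U n.+1 @[n --> \oo] --> 0.
  apply: (dot_cvg0 B m k m_gt0 B_norm _ _ (zeta ^+ 2) _ Br0) => n.
  rewrite -!sqr_fnorm -exprMn ler_pXn2r ?nnegrE ?fnorm_ge0 ?U_lip//.
  by rewrite mulr_ge0 ?fnorm_ge0.
have U0 : U n @[n --> \oo] --> 0 by rewrite -(cvg_shiftS U).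
have b0 := beta_gt0 Hst.
(* Moving [C] from [x_n] to [p_{n+1}] costs little: cocoercivity gives [|c n| <= |r n| / beta]. *)
pose c n := T (C (x n) - C (p n.+1)).
have c0 : c n @[n --> \oo] --> 0.
  apply: (dot_cvg0 B m k m_gt0 B_norm _ _ (beta ^- 2) _ Br0) => n.
  have := cocoercive_op (x n) (p n.+1); rewrite -/(c n) -/(r n).
  move: (c n) (r n) => cn rn h.
  rewrite mulrC ler_pdivlMr ?exprn_gt0//.
  have := dot_ge0 B (beta *: cn - rn); rewrite !dotE (dotC B cn rn).
  have := ler_wpM2l (ltW b0) h; lra.
(* [image_residual] holds at any point; here [p n.+1] takes the place of a zero. *)
pose e n := T (iterate_image n + C (p n.+1)).
have e0 : e n @[n --> \oo] --> 0.
  have -> : e = (fun n => (tau^-1 : R) *: (r n + U n - U n.+1) - c n).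
    by apply/funext => n; rewrite /e image_residual.
  have -> : (0 : H) = tau^-1 *: (0 + 0 - 0) - 0 by rewrite !subr0 addr0 scaler0.
  by apply: cvgB => //; apply: cvgZr; apply: cvgB => //; exact: cvgD.
have Se0 : iterate_image n + C (p n.+1) @[n --> \oo] --> 0.
  have [kS hkS] := Sb.
  apply: (@cvg_dist_le _ _ _ _ (fun n => kS * `|e n|)) => [n|].
    by rewrite sub0r normrN -[X in `|X|]TK; exact: hkS.
  rewrite -[0 in X in _ --> X](mulr0 kS); apply: cvgM; first exact: cvg_cst.
  by rewrite -(@normr0 _ H); exact: cvg_norm.
change (gra (op_add A (op_of_fun C)) (l, 0)).
refine (@sum_closed _ _ _ _ _ _ _ _ _ _ _ Hst (p \o succn \o phi)
  (fun n => iterate_image (phi n) + C (p (phi n).+1)) l 0 _ _ _).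
- move=> n; exists (iterate_image (phi n)); first exact: iterate_imageP.
  by exists (C (p (phi n).+1)).
- move=> y.
  have -> : (fun n => ip ((p \o succn \o phi) n) y) =
      (fun n => B (x (phi n)) (T y) - ip (r (phi n)) y).
    apply/funext => n /=; rewrite -ip_op_inv -dotNl -dotDl /r opprB.
    by rewrite addrC subrK.
  rewrite -[ip l y]subr0 ip_op_inv -(dot0l ip y); apply: cvgB; first exact: xl.
  have ip_norm v : 1 * `|v| ^+ 2 <= ip v v <= 1 * `|v| ^+ 2 by rewrite mul1r -Hip lexx.
  apply: (dot_cvgl ip 1 1 _ ip_norm) => //.
  exact: cvg_comp phioo r0.
- exact: cvg_comp phioo Se0.
Qed.

End Convergence.
End Iteration.
End Theta.
End Main.

(** * The modulus of [M] and the conclusion *)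

Lemma R_linear_cvg_cvg (R : realType) (H : completeNormedModType R) (x : nat -> H) (l : H) :
  R_linear_cvg x l -> x n @[n --> \oo] --> l.
Proof.
move=> [c [q [c0 /andP[q0 q1] xc]]].
apply: (@cvg_dist_le _ _ _ _ (geometric c q)) => [n|]; first by rewrite distrC xc.
by apply: cvg_geometric; rewrite ger0_norm ?ltW.
Qed.

(** Both bounds are triangle inequalities for [tauM_op]. The upper one shows that [(1 + zeta) / tau]
    is a Lipschitz constant and uses minimality; the lower one divides by the norm of a nonzero
    vector, as the modulus is 0 on the zero space. *)
Lemma lipschitz_modulus_bounds (R : realType) (H : completeNormedModType R)
    (ip B : {dot H for @idfun R}) (S : {linear H -> H}) (A : H -> set H) (C M : H -> H)
    (beta rho zeta tau zetaM : R) :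
  induces_norm ip -> (forall x y, B x y = ip x (S y)) ->
  standing_assumptions ip S A C M beta rho zeta tau ->
  is_lipschitz_modulus ip S M zetaM -> 0 < tau -> (exists h : H, h != 0) ->
  1 - zeta <= tau * zetaM <= 1 + zeta.
Proof.
move=> Hip BE Hst [_ Mlip Mmin] tau0 [h h0].
have z0 : 0 <= zeta by case/andP: (zeta_bounds Hst).
have tM x y := tauM_op ip S A C M beta rho zeta tau Hip Hst x y.
have Klip x y := kernel_lip ip B S A C M beta rho zeta tau Hip BE Hst x y.
have nT v := norm_wrt_op_inv ip B S A C M beta rho zeta tau Hip BE Hst v.
have nS v := norm_wrt_op ip B S BE v.
apply/andP; split.
  have fh : 0 < fnorm B h by rewrite /fnorm sqrtr_gt0 neq0_dnorm_gt0.
  rewrite -(ler_pM2r fh).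
  have := Mlip h 0; rewrite nT nS subr0 => /(ler_wpM2l (ltW tau0)).
  rewrite -fnormZ ?(ltW tau0)// -tM subr0 => M1.
  have := Klip 0 h; rewrite subr0 => K1.
  have := fnormD B (h - inv_op S (tauM_sub_S S M tau 0 - tauM_sub_S S M tau h))
    (inv_op S (tauM_sub_S S M tau 0 - tauM_sub_S S M tau h)).
  by rewrite subrK; lra.
have t1 : 0 <= (1 + zeta) / tau by rewrite divr_ge0 ?(ltW tau0)// addr_ge0.
rewrite mulrC -ler_pdivlMr//; apply: Mmin => // x y; rewrite nT nS.
rewrite mulrAC ler_pdivlMr// mulrC -fnormZ ?(ltW tau0)// -tM.
have := fnormD B (x - y) (- inv_op S (tauM_sub_S S M tau y - tauM_sub_S S M tau x)).
by rewrite fnormN; have := Klip y x; lra.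
Qed.

Theorem corollary3p12 (R : realType) (H : completeNormedModType R)
    (ip : {dot H for @idfun R}) (Hip : induces_norm ip)
    (S : {linear H -> H}) (A : H -> set H) (C M : H -> H)
    (beta rho zeta tau : R)
    (Hstanding : standing_assumptions ip S A C M beta rho zeta tau)
    (Hzer : zer_sum A C !=set0)
    (theta : R) (Htheta : 0 < theta < 2)
    (zetaM : R) (HzetaM : is_lipschitz_modulus ip S M zetaM)
    (xi : R) (Hxi : xi = tau * zetaM)
    (x u p : nat -> H) (Hgen : generated S A C M tau theta x u p)
    (theta_bar t1 : R) (t2 : \bar R)
    (Hsetting :
      [\/ setting_i S M beta rho zeta tau theta theta_bar t1 t2,
          setting_ii ip S C M rho zeta tau theta xi theta_bar t1 t2 |
          setting_iii ip S A M beta zeta tau theta theta_bar t1 t2])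
    (Htheta_bar : theta < theta_bar)
    (Ht1 : t1 < tau) (Ht2 : (tau%:E < t2)%E) :
  [/\ (exists h : H, h != 0) -> 1 - zeta <= xi <= 1 + zeta,
      exists2 z, zer_sum A C z & weakly_cvg ip x z &
      forall mu : R, 0 < mu ->
        semimonotone_on ip (zer_pairs A C) (fun h => mu *: S h)
          (fun h => rho *: inv_op S h) A ->
        exists2 z, zer_sum A C = [set z] & R_linear_cvg x z].
Proof.
have Ssa := S_self_adjoint Hstanding; have Ssm := S_strongly_monotone Hstanding.
have Sb := S_bounded Hstanding.
have [B BE] := op_form ip S Ssa Ssm.
have [m [k [m0 k0 Snorm]]] := op_form_norm ip S Hip Sb Ssm.
have B_norm v : m * `|v| ^+ 2 <= B v v <= k * `|v| ^+ 2 by rewrite BE.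
have [rho' [kappa [eps [[eps0 zk tau0] hdecr hreg hlin]]]] :
    admissible B S A C M beta rho zeta tau theta.
  have [zM0 Mlip _] := HzetaM; case: Hsetting => hs.
  - exact: (setting_i_admissible ip) hs Ht1 Ht2.
  - exact: (setting_ii_admissible ip) Mlip zM0 Hxi hs Ht1 Ht2.
  - exact: (setting_iii_admissible ip) hs Ht1 Ht2.
have zeta_itv := zeta_bounds Hstanding.
have step mu (reg : regular B S A C mu rho') n z (Zz : zer_sum A C z) :=
  potential_iterate ip B S A C M beta rho zeta tau Hip BE Hstanding theta Htheta
    x u p Hgen tau0 rho' kappa eps mu hdecr reg n z Zz.
have Ulip := U_lip ip B S A C M beta rho zeta tau Hip BE Hstanding theta x u p Hgen.
have nu0 : 0 <= 2 * theta * tau * 0 by rewrite mulr0.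
split.
- by rewrite Hxi; exact: (lipschitz_modulus_bounds _ _ ip B S A C M beta rho).
(* That [r_n] tends to 0 does not involve the zero, so a single [z0] settles it. *)
- have [z0 Zz0] := Hzer.
  have [_ Br0 _] := lyapunov_cvg B theta zeta kappa eps _ x p (inv_op S \o u) z0 Htheta zeta_itv
    zk eps0 nu0 Ulip (fun n => step 0 hreg n z0 Zz0).
  have [//|z Zz|phi l phin xl|z Zz xz] := opial B m k m0 k0 B_norm x (zer_sum A C).
  + exact: (fejer_cvg B theta zeta kappa eps _ x p (inv_op S \o u) z Htheta zeta_itv
      zk eps0 nu0 Ulip (fun n => step 0 hreg n z Zz)).
  + exact: (weak_cluster_zer ip B S A C M beta rho zeta tau Hip BE Hstanding
      theta x u p Hgen tau0 m k m0 B_norm phi l Br0 phin xl).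
  (* Testing against [y] in [ip] is testing against [S^-1 y] in [B]. *)
  + exists z => // y; rewrite -(op_invK ip S Hip Sb Ssa Ssm y) -BE.
    by under eq_fun do rewrite -BE; exact: xz.
- move=> mu mu0 /(regular_semimonotone ip B S A C M beta rho zeta tau Hip BE Hstanding).
  move=> /(hlin _ mu0)[mu' mu'0 reg].
  have nu1 : 0 < 2 * theta * tau * mu'.
    by case/andP: Htheta => ? _; rewrite !mulr_gt0.
  have lin z (Zz : zer_sum A C z) : R_linear_cvg x z.
    exact: (linear_cvg B m k m0 B_norm theta zeta kappa eps _ x p (inv_op S \o u) z Htheta zeta_itv
      zk eps0 Ulip (fun n => step mu' reg n z Zz) nu1).
  (* Uniqueness of the zero follows from uniqueness of limits: the sequence converges to each
     zero. *)
  have [z Zz] := Hzer; exists z; last exact: lin.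
  apply/seteqP; split => [z' Zz'|z' ->//] /=.
  by apply: (cvg_unique (@norm_hausdorff _ _) (R_linear_cvg_cvg _ _ _ _ (lin _ Zz'))
    (R_linear_cvg_cvg _ _ _ _ (lin _ Zz))).
Qed.
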